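(* Let $\mathbb{G}\le\mathbb{U}$ be a Lie subgroup of a Banach Lie group. (1) If $S\subseteq\mathbb{U}$ is an ad-bounded subset, then there is a neighborhood $U$ of the identity $1\in\mathbb{U}$ such that $$\sup_{\substack{\mathbb{H}\le\mathbb{U}\\ |\mathbb{H}|<\infty\\ \mathbb{H}\subset(\mathbb{G}\cdot U)\cap S}}\ \inf_{\substack{\mathbb{A}\trianglelefteq\mathbb{H}\\ \mathbb{A}\text{ abelian}}}|\mathbb{H}/\mathbb{A}|\ \le\ J_{\mathbb{G}}.$$ (2) If $\mathbb{G}$ is compact, then $$\inf_{U}\ \sup_{\substack{\mathbb{H}\le\mathbb{U}\\ |\mathbb{H}|<\infty\\ \mathbb{H}\subset\mathbb{G}\cdot U}}\ \inf_{\substack{\mathbb{A}\trianglelefteq\mathbb{H}\\ \mathbb{A}\text{ abelian}}}|\mathbb{H}/\mathbb{A}|\ \le\ J_{\mathbb{G}},$$ where the outer infimum is over all neighborhoods $U$ of $1$ in $\mathbb{U}$.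
   Context: A Banach Lie group is a topological group that is also a (possibly infinite-dimensional) analytic Banach manifold, with analytic multiplication and inversion. Its Lie algebra $\mathfrak{u}=Lie(\mathbb{U})$ is a Banach space carrying the adjoint representation $\mathrm{Ad}:\mathbb{U}\to GL(\mathfrak{u})$. A subset $S\subseteq\mathbb{U}$ is ad-bounded if $\mathrm{Ad}(S)\subset GL(\mathfrak{u})$ is bounded in operator norm. A Lie subgroup of $\mathbb{U}$ is meant in the strong (Bourbaki) sense: a subgroup that is an (embedded, split) submanifold; in particular it is closed, is a Banach Lie group in its own right, and its Lie algebra is a complemented closed subspace of $\mathfrak{u}$. $\mathbb{G}\cdot U=\{gu : g\in\mathbb{G},\ u\in U\}$. The Jordan constant of a group $\mathbb{G}$ is $$J_{\mathbb{G}}:=\sup_{\substack{\mathbb{H}\le\mathbb{G}\\ |\mathbb{H}|<\infty}}\ \inf_{\substack{\mathbb{A}\trianglelefteq\mathbb{H}\\ \mathbb{A}\text{ abelian}}}|\mathbb{H}/\mathbb{A}|\in[1,\infty].$$ In all these expressions $\mathbb{H}$ ranges over finite subgroups (of the indicated group, contained in the indicated set) and $\mathbb{A}$ over abelian normal subgroups of $\mathbb{H}$; suprema may be infinite, and a supremum over the empty family is $0$. *)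

(* Defs.v *)
From HB Require Import structures.
From mathcomp Require Import all_boot all_order all_algebra.
From mathcomp Require Import finmap.
From mathcomp Require Import all_classical all_reals all_analysis.
Set Implicit Arguments.
Unset Strict Implicit.
Unset Printing Implicit Defensive.
Import Order.TTheory GRing.Theory Num.Theory.
Import numFieldNormedType.Exports.
Local Open Scope classical_set_scope.
Local Open Scope ring_scope.

Section Jordan.
Variable G : groupType.
Local Open Scope group_scope.

Definition subgroup (H : set G) : Prop :=
  [/\ H 1, forall x y, H x -> H y -> H (x * y) & forall x, H x -> H x^-1].

Definition abelian_normal_subgroup (A H : set G) : Prop :=
  [/\ subgroup A, A `<=` H,
      forall h a, H h -> A a -> A (h * a * h^-1)
    & forall a b, A a -> A b -> a * b = b * a].

Definition left_cosets (H A : set G) : set (set G) :=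
  [set [set h * a | a in A] | h in H].

(* Only meaningful when there are finitely many cosets: [fset_set] of an
   infinite set is empty. *)
Definition group_index (H A : set G) : nat := #|` fset_set (left_cosets H A)|.

Variable R : realType.

Definition min_abelian_index (H : set G) : \bar R :=
  ereal_inf [set ((group_index H A)%:R)%:E | A in
               [set A | abelian_normal_subgroup A H]].

(* The element 0 is adjoined because [ereal_sup set0] is -oo, whereas the
   supremum over an empty family of finite subgroups is meant to be 0 here.
   When [X] is a subgroup, this is its Jordan constant. *)
Definition jordan_constant (X : set G) : \bar R :=
  ereal_sup ([set 0%E] `|`
    [set min_abelian_index H | H in
      [set H | [/\ subgroup H, finite_set H & H `<=` X]]]).

End Jordan.
Arguments jordan_constant {G} R X.

HB.structure Definition PreTopologicalGroup := {G of Group G & Topological G}.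

HB.mixin Record isTopologicalGroup G of PreTopologicalGroup G := {
  mulg_continuous : continuous (fun z : G * G => (z.1 * z.2)%g) ;
  invg_continuous : continuous (fun x : G => (x^-1)%g)
}.

#[short(type="topologicalGroupType")]
HB.structure Definition TopologicalGroup :=
  {G of isTopologicalGroup G & PreTopologicalGroup G}.

Section Analytic.
Variables (R : realType) (V W : normedModType R).

Definition multilinear n (m : ('I_n -> V) -> W) : Prop :=
  forall (i : 'I_n) (v : 'I_n -> V) (a : R) (x y : V),
    m [eta v with i |-> a *: x + y] =
    a *: m [eta v with i |-> x] + m [eta v with i |-> y].

(* Power series with a positive radius of convergence: the degree-n term is the
   restriction to the diagonal of a continuous n-linear map of norm at most
   [C * A ^+ n]. *)
Definition analytic_at (f : V -> W) (x : V) : Prop :=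
  exists (p : forall n, ('I_n -> V) -> W) (C A : R),
    [/\ forall n, multilinear (p n),
        forall n v, `|p n v| <= C * A ^+ n * \prod_(i < n) `|v i|
      & \forall h \near (0 : V), series (fun n => p n (fun=> h)) @ \oo --> f (x + h)].

End Analytic.

Section Manifold.
Variables (R : realType) (M : topologicalType) (E : normedModType R).

(* [chart_map] and [chart_inv] are total functions whose values outside
   [chart_dom] and its image are irrelevant. *)
Record chart := Chart {
  chart_dom : set M ;
  chart_map :> M -> E ;
  chart_inv : E -> M ;
  chart_dom_open : open chart_dom ;
  chart_img_open : open (chart_map @` chart_dom) ;
  chart_mapK : forall x, chart_dom x -> chart_inv (chart_map x) = x ;
  chart_map_continuous : forall x, chart_dom x -> {for x, continuous chart_map} ;
  chart_inv_continuous : forall v, (chart_map @` chart_dom) v ->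
    {for v, continuous chart_inv}
}.

Definition chart_compatible (c d : chart) : Prop :=
  forall x, chart_dom c x -> chart_dom d x ->
    analytic_at (d \o chart_inv c) (c x) /\ analytic_at (c \o chart_inv d) (d x).

Record atlas := Atlas {
  atlas_charts : set chart ;
  atlas_cover : forall x, exists2 c, atlas_charts c & chart_dom c x ;
  atlas_compatible : forall c d, atlas_charts c -> atlas_charts d ->
    chart_compatible c d
}.

Definition linear_subspace (F : set E) : Prop :=
  F 0 /\ forall (a : R) u v, F u -> F v -> F (a *: u + v).

(* [E] is the topological direct sum of [F] and [F']. *)
Definition topological_complement (F F' : set E) : Prop :=
  [/\ linear_subspace F /\ closed F, linear_subspace F' /\ closed F',
      F `&` F' = [set 0]
    & exists2 p : E -> E, continuous p & forall v, F (p v) /\ F' (v - p v)].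

Definition split_subspace (F : set E) : Prop :=
  exists F', topological_complement F F'.

(* The charts adapted to [Y] are charts of the analytic structure, i.e. members
   of the maximal atlas containing [A], and not just of [A]. *)
Definition split_submanifold (A : atlas) (Y : set M) : Prop :=
  forall y, Y y -> exists (c : chart) (F : set E),
    [/\ chart_dom c y, forall d, atlas_charts A d -> chart_compatible c d, split_subspace F
      & c @` (chart_dom c `&` Y) = (c @` chart_dom c) `&` F].

End Manifold.

(* Translations are analytic diffeomorphisms, so a single model space suffices
   for a group. Multiplication is read in the product charts of the product
   manifold. *)
Record banachLieGroup (R : realType) := BanachLieGroup {
  lie_group :> topologicalGroupType ;
  lie_model : completeNormedModType R ;
  lie_atlas : atlas lie_group lie_model ;
  lie_mul_analytic : forall (c d e : chart lie_group lie_model) x y,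
    atlas_charts lie_atlas c -> atlas_charts lie_atlas d ->
    atlas_charts lie_atlas e ->
    chart_dom c x -> chart_dom d y -> chart_dom e (x * y)%g ->
    analytic_at
      (fun z : lie_model * lie_model => e (chart_inv c z.1 * chart_inv d z.2)%g)
      (c x, d y) ;
  lie_inv_analytic : forall (c e : chart lie_group lie_model) x,
    atlas_charts lie_atlas c -> atlas_charts lie_atlas e ->
    chart_dom c x -> chart_dom e (x^-1)%g ->
    analytic_at (fun v : lie_model => e ((chart_inv c v)^-1)%g) (c x)
}.

Section LieGroup.
Variables (R : realType) (U : banachLieGroup R).

(* A chart [c] around 1 identifies the Lie algebra, i.e. the tangent space at 1,
   with the model space; [Ad c g] is the differential at 1 of the conjugation
   x |-> g x g^-1 under this identification. *)
Definition Ad (c : chart U (lie_model U)) (g : U) : lie_model U -> lie_model U :=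
  'd (fun v : lie_model U => c (g * chart_inv c v * g^-1)%g) (c 1%g).

(* The norms given to the Lie algebra by two charts around 1 are equivalent, so
   the choice of [c] does not matter. *)
Definition ad_bounded (S : set U) : Prop :=
  exists c : chart U (lie_model U),
    [/\ atlas_charts (lie_atlas U) c, chart_dom c 1%g
      & exists C : R, forall g, S g -> forall v, `|Ad c g v| <= C * `|v|].

Definition lie_subgroup (G : set U) : Prop :=
  subgroup G /\ split_submanifold (lie_atlas U) G.

End LieGroup.

Definition set_mulg (G : groupType) (A B : set G) : set G :=
  [set (a * b)%g | a in A & b in B].

(* Main.v *)
(** A finite subgroup H of G.U with bounded adjoint action is conjugate into G,
    so its Jordan index is at most that of a finite subgroup of G.  In a chart
    at 1 adapted to G, with inverse c, write h = g_h c(w_h) with g_h in G and w_h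
    small.  Let q be the projection along Lie(G).  The equation for hk says that h |-> q w_h
    is a cocycle up to a quadratic error; averaging it over H shows that it is
    almost the coboundary of the mean of the w_h, so conjugating by
    y = c(- mean(w_h)) moves H quadratically closer to G.  Iterating this Newton step converges because the model space
    is complete, and G is closed near 1.  The step needs the conjugations by H to be
    linear up to a quadratic error that depends only on a bound for Ad; instead of
    the exponential map, this is obtained by splitting a segment [0, v] into N
    pieces, whose images under conjugation multiply up, and letting N go to
    infinity.  If G is compact, Ad is bounded on a neighborhood of G. *)

From HB Require Import structures.
Require Import Defs.
From mathcomp Require Import all_boot all_order all_algebra finmap.
From mathcomp Require Import all_classical all_reals all_analysis ring lra.
Set Implicit Arguments.
Unset Strict Implicit.
Unset Printing Implicit Defensive.
Import Order.TTheory GRing.Theory Num.Theory.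
Import numFieldNormedType.Exports.
Local Open Scope classical_set_scope.
Local Open Scope ring_scope.

(** The neighborhood has to be chosen before [H], whose order is not bounded, so the constants may
    depend on the chart and on a bound for Ad, but never on [H] or on the number of Newton steps.
    Averaging respects this, since a mean of cocycle errors is no larger than the largest of them.
    The map [h |-> g_h] is not a homomorphism, but its defect lies in [G] and is therefore invisible
    to [q]; this is what leaves a cocycle relation at first order. The conjugators accumulate to a
    single [ch x] with [x] in a fixed small ball, so Ad on the moving group stays within a fixed
    multiple of its original bound, and the same constants serve at every step. Analyticity enters
    through two consequences: bounded second differences, which make products in the chart additive
    up to quadratic errors, and the existence of derivatives. Once [H] is conjugate into [G], its
    conjugate is one of the subgroups in the supremum that defines the Jordan constant of [G]. *)

(* A reflexive decision procedure for linear identities in a zmodType, where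
   [ring] does not apply. *)
Inductive zexpr := ZVar of nat | ZZero | ZAdd of zexpr & zexpr | ZOpp of zexpr.

Fixpoint zeval (V : zmodType) (env : seq V) (e : zexpr) : V :=
  match e with
  | ZVar i => nth 0 env i
  | ZZero => 0
  | ZAdd e1 e2 => zeval env e1 + zeval env e2
  | ZOpp e1 => - zeval env e1
  end.

Fixpoint zcoef (e : zexpr) (i : nat) : int :=
  match e with
  | ZVar j => ((i == j)%:R : int)
  | ZZero => 0
  | ZAdd e1 e2 => zcoef e1 i + zcoef e2 i
  | ZOpp e1 => - zcoef e1 i
  end.

Lemma zevalE (V : zmodType) (env : seq V) e :
  zeval env e = \sum_(i < size env) env`_i *~ zcoef e i.
Proof.
elim: e => [j||e1 IH1 e2 IH2|e1 IH1] /=.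
- have [jn|nj] := ltnP j (size env).
    rewrite (bigD1 (Ordinal jn)) //= eqxx big1 ?addr0// => i.
    by rewrite -val_eqE /= => /negbTE ->.
  rewrite nth_default // big1 // => i _.
  by rewrite (ltn_eqF (leq_trans (ltn_ord i) nj)).
- by rewrite big1.
- by rewrite IH1 IH2 -big_split; apply: eq_bigr => i _; rewrite mulrzDr.
- by rewrite IH1 -sumrN; apply: eq_bigr => i _; rewrite mulrNz.
Qed.

Lemma zexpr_eq (V : zmodType) (env : seq V) e1 e2 :
  all (fun i => zcoef e1 i == zcoef e2 i) (iota 0 (size env)) ->
  zeval env e1 = zeval env e2.
Proof.
move=> /allP e12; rewrite !zevalE; apply: eq_bigr => i _.
by rewrite (eqP (e12 _ _)) // mem_iota /= ltn_ord.
Qed.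

Ltac zmod_index t env :=
  lazymatch env with
  | t :: _ => constr:(0%N)
  | _ :: ?env' => let n := zmod_index t env' in constr:(n.+1)
  end.
Ltac zmod_mem t env :=
  lazymatch env with
  | t :: _ => constr:(true)
  | _ :: ?env' => zmod_mem t env'
  | _ => constr:(false)
  end.
Ltac zmod_env t env :=
  lazymatch t with
  | (?a + ?b)%R => let env' := zmod_env a env in zmod_env b env'
  | (- ?a)%R => zmod_env a env
  | (0)%R => env
  | _ => lazymatch zmod_mem t env with
         | true => env
         | false => constr:(t :: env)
         end
  end.
Ltac zmod_reify t env :=
  lazymatch t with
  | (?a + ?b)%R =>
      let a' := zmod_reify a env in let b' := zmod_reify b env in
      constr:(ZAdd a' b')
  | (- ?a)%R => let a' := zmod_reify a env in constr:(ZOpp a')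
  | (0)%R => constr:(ZZero)
  | _ => let n := zmod_index t env in constr:(ZVar n)
  end.
Ltac zmod :=
  lazymatch goal with
  | |- ?a = ?b =>
      let T := type of a in
      let env0 := zmod_env a (@nil T) in
      let env := zmod_env b env0 in
      let ea := zmod_reify a env in
      let eb := zmod_reify b env in
      refine (@zexpr_eq _ env ea eb _); vm_compute; reflexivity
  end.

Lemma eq_ler (R : numDomainType) (x y : R) : x = y -> x <= y.
Proof. by move=> ->. Qed.

(** * Difference estimates for bounded multilinear maps *)

Section Multilinear.
Variables (R : realType) (V W : normedModType R) (n : nat).
Variables (m : ('I_n -> V) -> W) (M : R).
Hypothesis mlin : multilinear m.
Hypothesis M_ge0 : 0 <= M.
Hypothesis m_le : forall v, `|m v| <= M * \prod_(i < n) `|v i|.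

Lemma multilinearB (i : 'I_n) (v : 'I_n -> V) (x y : V) :
  m [eta v with i |-> x] - m [eta v with i |-> y] = m [eta v with i |-> x - y].
Proof.
by have H := mlin i v (-1) y x; rewrite !scaleN1r in H; rewrite addrC -H (addrC x).
Qed.

(** Consecutive hybrids differ in a single slot, where multilinearity applies; summing over the
    slots telescopes from [w] to [v]. *)
Definition hybrid (v w : 'I_n -> V) (k : nat) : 'I_n -> V :=
  fun i => if (i < k)%N then v i else w i.

Lemma multilinear_telescope (v w : 'I_n -> V) :
  m v - m w = \sum_(k < n) m [eta hybrid v w k with k |-> v k - w k].
Proof.
have -> : m v = m (hybrid v w n).
  by congr m; apply/funext => i; rewrite /hybrid ltn_ord.
have -> : m w = m (hybrid v w 0) by congr m; apply/funext => i.
rewrite -(telescope_sumr (fun k => m (hybrid v w k)) (leq0n n)) big_mkord.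
apply: eq_bigr => k _; rewrite -multilinearB.
congr (m _ - m _); apply/funext => i /=; rewrite /hybrid ?ltnS.
  by have [->|ik] := eqVneq i k; rewrite ?leqnn // leq_eqVlt (negbTE ik : (i == k :> nat) = false).
by have [->|//] := eqVneq i k; rewrite ltnn.
Qed.

(** The radii depend on the slot because second differences put [|s|] into one slot and [rho] into
    the others. Differences are measured relative to these radii, so all [n] summands get the same
    bound. *)
Lemma multilinear_diff_le (v w : 'I_n -> V) (rho : 'I_n -> R) (tau : R) :
  0 <= tau -> (forall i, `|v i| <= rho i) -> (forall i, `|w i| <= rho i) ->
  (forall i, `|v i - w i| <= tau * rho i) ->
  `|m v - m w| <= n%:R * (M * tau * \prod_(i < n) rho i).
Proof.
move=> tau0 vr wr vwr; rewrite multilinear_telescope.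
apply: le_trans (ler_norm_sum _ _ _) _.
rewrite -[n in n%:R]card_ord mulr_natl -sumr_const; apply: ler_sum => k _.
apply: le_trans (m_le _) _; rewrite -mulrA ler_wpM2l //.
rewrite (bigD1 k) //= eqxx [in leRHS](bigD1 k) //= mulrA.
apply: ler_pM => //; first by apply: prodr_ge0 => i _; exact: normr_ge0.
by apply: ler_prod => i /negbTE ->; rewrite normr_ge0 /hybrid /=; case: ifP => _;
  [exact: vr|exact: wr].
Qed.

Lemma multilinear_diag_diff_le (a b : V) (rho : R) :
  0 < rho -> `|a| <= rho -> `|b| <= rho ->
  `|m (fun=> a) - m (fun=> b)| <= n%:R * M * rho ^+ n / rho * `|a - b|.
Proof.
move=> r0 ar br.
have := @multilinear_diff_le (fun=> a) (fun=> b) (fun=> rho) (`|a - b| / rho).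
rewrite prodr_const card_ord divfK ?gt_eqF// => H.
apply: le_trans (H _ _ _ _) _ => //; first by rewrite divr_ge0 // ltW.
by apply: eq_ler; ring.
Qed.

(** Telescoping in [s] gives [n] terms with [s] in one slot, and telescoping each of them in [t]
    gives [n] more, hence [n ^+ 2]. Two slots trade [rho] for [|s|] and [|t|], hence the division by
    [rho ^+ 2]. *)
Lemma multilinear_diag_diff2_le (a s t : V) (rho : R) :
  0 < rho -> `|a| <= rho -> `|a + s| <= rho -> `|a + t| <= rho ->
  `|a + s + t| <= rho ->
  `|m (fun=> a + s + t) - m (fun=> a + s) - m (fun=> a + t) + m (fun=> a)|
    <= n%:R ^+ 2 * M * rho ^+ n / rho ^+ 2 * (`|s| * `|t|).
Proof.
move=> r0 ar asr atr astr.
have -> : m (fun=> a + s + t) - m (fun=> a + s) - m (fun=> a + t) + m (fun=> a)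
   = (m (fun=> a + t + s) - m (fun=> a + t)) - (m (fun=> a + s) - m (fun=> a)).
  by rewrite (addrAC a t) opprB addrA [RHS]addrAC; congr (_ + _); exact: addrAC.
rewrite !multilinear_telescope -sumrB.
apply: le_trans (ler_norm_sum _ _ _) _.
have -> : n%:R ^+ 2 * M * rho ^+ n / rho ^+ 2 * (`|s| * `|t|) =
   n%:R * (n%:R * M * rho ^+ n / rho ^+ 2 * (`|s| * `|t|)) by ring.
rewrite mulr_natl -[X in _ *+ X]card_ord -sumr_const.
apply: ler_sum => k _.
rewrite !(addrC _ s) !addrK.
pose rk (i : 'I_n) := if i == k then `|s| else rho.
apply: le_trans (@multilinear_diff_le _ _ rk (`|t| / rho) _ _ _ _) _.
- by rewrite divr_ge0 // ltW.
- by move=> i /=; rewrite /rk /hybrid; case: ifP => // _; case: ifP; rewrite // ?(addrC s) // addrAC.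
- by move=> i /=; rewrite /rk /hybrid; case: ifP => // _; case: ifP; rewrite // ?(addrC s).
- move=> i /=; rewrite /rk /hybrid; case: ifP => // _.
    by rewrite subrr normr0 mulr_ge0 // divr_ge0 // ltW.
  rewrite divfK ?gt_eqF//; case: ifP => _.
    by rewrite opprD addrACA subrr add0r addrAC subrr add0r.
  by rewrite addrAC subrr add0r.
rewrite /rk (bigD1 k) //= eqxx.
rewrite (eq_bigr (fun=> rho)); last by move=> i /negbTE ->.
rewrite prodr_const.
have -> : rho ^+ n = rho * rho ^+ #|[pred i | i != k]|.
  by rewrite -exprS; congr (_ ^+ _); rewrite -[LHS]card_ord (cardD1 k) /=;
    congr (_.+1); apply: eq_card => i; rewrite !inE andbT.
apply: eq_ler; field; exact: lt0r_neq0.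
Qed.

End Multilinear.

(* A derivative-free form of C^{1,1} regularity: bounding second differences,
   rather than the Lipschitz constant of the derivative, gives a class that is
   closed under composition by elementary estimates. *)
Definition C11_at (R : realType) (V W : normedModType R) (f : V -> W) (x : V) :=
  exists K r : R, [/\ 0 <= K, 0 < r,
    forall a b, `|a - x| < r -> `|b - x| < r -> `|f a - f b| <= K * `|a - b|
  & forall a s t, `|a - x| < r -> `|a + s - x| < r -> `|a + t - x| < r ->
      `|a + s + t - x| < r ->
      `|f (a + s + t) - f (a + s) - f (a + t) + f a| <= K * (`|s| * `|t|)].

(** Frechet differentiability in elementary form, tied to ['d] by [fderiv_diff]. The operator bound
    is carried along because the norms of derivatives of chart changes enter the bounds for Ad. *)
Definition fderiv (R : realType) (V W : normedModType R) (f : V -> W) (x : V)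
    (L : V -> W) :=
  [/\ forall (a : R) u v, L (a *: u + v) = a *: L u + L v,
      exists2 B, 0 <= B & forall v, `|L v| <= B * `|v|
    & forall eta : R, 0 < eta -> exists2 delta, 0 < delta &
        forall h, `|h| < delta -> `|f (x + h) - f x - L h| <= eta * `|h|].

(** * From power series to difference bounds and derivatives *)

Section AnalyticEstimates.
Variables (R : realType) (V W : normedModType R).

Lemma cvg_norm_le (u : nat -> W) (l : W) (B : R) (k : nat) :
  u @ \oo --> l -> (forall n, (k <= n)%N -> `|u n| <= B) -> `|l| <= B.
Proof.
move=> /cvg_norm ul uB.
have := @ler_cvg_to _ \oo _ R (fun n => `|u n|) (fun=> B) `|l| B ul (cvg_cst _).
by apply; exists k => // n /= /uB.
Qed.

Lemma geometric_half_le (n : nat) (B : R) : 0 <= B ->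
  \sum_(0 <= k < n) B * 2^-1 ^+ k <= 2 * B.
Proof.
move=> B0; suff -> : \sum_(0 <= k < n) B * 2^-1 ^+ k = 2 * B - 2 * B * 2^-1 ^+ n.
  by rewrite gerBl mulr_ge0 ?mulr_ge0 ?exprn_ge0 ?invr_ge0.
elim: n => [|n IH]; first by rewrite big_nil expr0 mulr1 subrr.
by rewrite big_nat_recr //= IH exprS; field.
Qed.

Lemma natr_le_2expn (n : nat) : n%:R <= 2 ^+ n :> R.
Proof. by rewrite -natrX ler_nat ltnW // ltn_expl. Qed.

(** Shrinking the radius to at most [1 / (8 * max(1, |A|))] makes the terms decay like [8^-1 ^+ n].
    The 8 absorbs the factor [n ^+ 2] of second differences: [n <= 2 ^+ n] and [4 / 8 = 1 / 2] leave
    a geometric series of ratio one half. *)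
Lemma analytic_normal_form (f : V -> W) (x : V) : analytic_at f x ->
  exists (p : forall n, ('I_n -> V) -> W) (C rho : R),
  [/\ 0 <= C /\ 0 < rho, forall n, multilinear (p n),
      forall n v, `|p n v| <= C * (8 * rho)^-1 ^+ n * \prod_(i < n) `|v i|
    & forall h, `|h| < rho -> series (fun n => p n (fun=> h)) @ \oo --> f (x + h)].
Proof.
move=> [p [C [A [pl pb pc]]]].
move/nbhs_ballP: pc => [e /= e0 He].
pose rho := Num.min e (8 * Num.max 1 `|A|)^-1.
have mA : 1 <= Num.max 1 `|A| by rewrite le_max lexx.
have rho0 : 0 < rho by rewrite lt_min e0 invr_gt0 mulr_gt0 // (lt_le_trans _ mA).
exists p, `|C|, rho; split => //.
  move=> n v; apply: le_trans (pb n v) _.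
  apply: le_trans (ler_norm _) _; rewrite !normrM normrX.
  rewrite normr_prod (eq_bigr (fun i => `|v i|)); last by move=> i _; rewrite normr_id.
  apply: ler_wpM2r; first by apply: prodr_ge0 => i _; exact: normr_ge0.
  apply: ler_wpM2l => //.
  apply: lerXn2r; rewrite ?nnegrE ?invr_ge0 ?mulr_ge0 ?(ltW rho0)//.
  have A0 : 0 < Num.max 1 `|A| by exact: lt_le_trans mA.
  apply: (@le_trans _ _ (Num.max 1 `|A|)); first by rewrite le_max lexx orbT.
  rewrite -[leLHS]invrK lef_pV2 ?posrE ?invr_gt0 ?mulr_gt0//.
  rewrite mulrC -ler_pdivlMr// -invfM mulrC.
  by rewrite /rho ge_min lexx orbT.
move=> h hr; apply: He; rewrite -ball_normE /= sub0r normrN.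
by apply: lt_le_trans hr _; rewrite /rho ge_min lexx.
Qed.

Lemma rho_ratio (rho : R) (n : nat) : 0 < rho ->
  (8 * rho)^-1 ^+ n * rho ^+ n = 8^-1 ^+ n.
Proof.
by move=> r0; rewrite -exprMn; congr (_ ^+ _); field; exact: lt0r_neq0.
Qed.

Lemma natr_sqr_mul_8V_le (k : nat) : k%:R ^+ 2 * 8^-1 ^+ k <= 2^-1 ^+ k :> R.
Proof.
apply: (@le_trans _ _ ((2 ^+ k) ^+ 2 * 8^-1 ^+ k)).
  apply: ler_wpM2r; first by rewrite exprn_ge0 // invr_ge0.
  by rewrite lerXn2r ?nnegrE ?exprn_ge0 ?natr_le_2expn.
by rewrite -exprM mulnC exprM -exprMn; apply: lerXn2r; rewrite ?nnegrE; lra.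
Qed.

Lemma natr_mul_8V_le (k : nat) : k%:R * 8^-1 ^+ k <= 2^-1 ^+ k :> R.
Proof.
apply: le_trans (natr_sqr_mul_8V_le k).
apply: ler_wpM2r; first by rewrite exprn_ge0 // invr_ge0.
by rewrite -natrX ler_nat; case: k => // k; rewrite leq_pmulr.
Qed.

(** Both differences are bounded term by term on the partial sums, and these bounds pass to the
    limit, so the series is never differentiated. *)
Lemma analytic_C11 (f : V -> W) (x : V) : analytic_at f x -> C11_at f x.
Proof.
move=> /analytic_normal_form[p [C [rho [[C0 r0] pl pb pc]]]].
have M0 n : 0 <= C * (8 * rho)^-1 ^+ n.
  by rewrite mulr_ge0 // exprn_ge0 // invr_ge0 mulr_ge0 // ltW.
pose P h n := p n (fun=> h).
have fP a : `|a - x| < rho -> series (P (a - x)) @ \oo --> f a.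
  by move=> /pc; rewrite (_ : x + (a - x) = a) //; zmod.
pose K := Num.max (2 * (C / rho)) (2 * (C / rho ^+ 2)).
have Cr : 0 <= C / rho by rewrite divr_ge0 // ltW.
have Cr2 : 0 <= C / rho ^+ 2 by rewrite divr_ge0 // exprn_ge0 // ltW.
exists K, rho; split => //.
- by rewrite le_max mulr_ge0.
- move=> a b ax bx.
  apply: (cvg_norm_le (k := 0) (cvgB (fP _ ax) (fP _ bx))) => n _.
  rewrite !fctE /series /= -sumrB; apply: le_trans (ler_norm_sum _ _ _) _.
  apply: (@le_trans _ _ (\sum_(0 <= k < n) (C / rho * `|a - b|) * 2^-1 ^+ k)).
    apply: ler_sum => k _; rewrite /P.
    have := multilinear_diag_diff_le (pl k) (M0 k) (pb k) r0 (ltW ax) (ltW bx).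
    rewrite (_ : a - x - (b - x) = a - b); last by zmod.
    move=> /le_trans; apply.
    rewrite [leLHS](_ : _ = C / rho * `|a - b| * (k%:R * 8^-1 ^+ k)); last first.
      by rewrite -(rho_ratio k r0); ring.
    by apply: ler_wpM2l; [exact: mulr_ge0|exact: natr_mul_8V_le].
  apply: le_trans (geometric_half_le _ _) _; first by rewrite mulr_ge0.
  by rewrite mulrA ler_wpM2r // /K le_max lexx.
- move=> a s t ax asx atx astx.
  apply: (cvg_norm_le (k := 0)
    (cvgD (cvgB (cvgB (fP _ astx) (fP _ asx)) (fP _ atx)) (fP _ ax))) => n _.
  rewrite !fctE /series /= -!sumrB -big_split /=; apply: le_trans (ler_norm_sum _ _ _) _.
  apply: (@le_trans _ _ (\sum_(0 <= k < n) (C / rho ^+ 2 * (`|s| * `|t|)) * 2^-1 ^+ k)).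
    apply: ler_sum => k _; rewrite /P.
    have := @multilinear_diag_diff2_le _ _ _ k _ _ (pl k) (M0 k) (pb k)
      (a - x) s t rho r0 (ltW ax).
    rewrite !(addrAC a (- x)) !(addrAC _ (- x)) => /(_ (ltW asx) (ltW atx) (ltW astx)).
    move=> /le_trans; apply.
    rewrite [leLHS](_ : _ = C / rho ^+ 2 * (`|s| * `|t|) * (k%:R ^+ 2 * 8^-1 ^+ k)).
      apply: ler_wpM2l; last exact: natr_sqr_mul_8V_le.
      by apply: mulr_ge0 => //; exact: mulr_ge0.
    by rewrite -(rho_ratio k r0); ring.
  apply: le_trans (geometric_half_le _ _) _; first by apply: mulr_ge0 => //; exact: mulr_ge0.
  by rewrite mulrA ler_wpM2r ?mulr_ge0 // /K le_max lexx orbT.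
Qed.

Lemma multilinear_diag_additive1 (m : ('I_1 -> V) -> W) : multilinear m ->
  forall (a : R) u v, m (fun=> a *: u + v) = a *: m (fun=> u) + m (fun=> v).
Proof.
move=> ml a u v; have := ml ord0 (fun=> 0) a u v.
have E z : m [eta (fun _ : 'I_1 => 0 : V) with ord0 |-> z] = m (fun _ : 'I_1 => z).
  by congr m; apply/funext => i /=; rewrite ord1.
by rewrite !E.
Qed.

Lemma analytic_fderiv (f : V -> W) (x : V) : analytic_at f x ->
  exists L, fderiv f x L.
Proof.
move=> /analytic_normal_form[p [C [rho [[C0 r0] pl pb pc]]]].
pose P h n := p n (fun=> h).
exists (fun h => P h 1%N); split.
- exact: multilinear_diag_additive1.
- exists (C * (8 * rho)^-1); first by rewrite mulr_ge0 // invr_ge0 mulr_ge0 // ltW.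
  by move=> v; have := pb 1%N (fun=> v); rewrite big_ord_recl big_ord0 expr1 mulr1.
pose B := 2 * (C / rho ^+ 2).
have B0 : 0 <= B by rewrite mulr_ge0 // divr_ge0 // exprn_ge0 // ltW.
have key h : `|h| < rho -> `|f (x + h) - f x - P h 1%N| <= B * `|h| ^+ 2.
  move=> hr; have := pc 0; rewrite normr0 addr0 => /(_ r0) p0.
  (* From two terms on, the constant and linear terms cancel in the partial sums and a tail of
     quadratic size remains. *)
  apply: (cvg_norm_le (k := 2) (cvgB (cvgB (pc h hr) p0) (cvg_cst (P h 1%N)))).
  move=> -[|[|n]] // _; rewrite !fctE /series /=.
  rewrite -sumrB big_nat_recl // big_nat_recl //=.
  rewrite (_ : p 0%N (fun=> h) = p 0%N (fun=> 0)); last first.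
    by congr (p 0%N _); apply/funext => -[].
  have Pz k : p k.+1 (fun=> 0) = 0.
    apply/eqP; rewrite -normr_le0; apply: le_trans (pb _ _) _.
    by rewrite prodr_const card_ord normr0 expr0n mulr0.
  rewrite subrr add0r Pz subr0 addrAC subrr add0r.
  apply: le_trans (ler_norm_sum _ _ _) _.
  apply: (@le_trans _ _ (\sum_(0 <= k < n) (C / rho ^+ 2 * `|h| ^+ 2) * 2^-1 ^+ k)).
    apply: ler_sum => k _; rewrite Pz subr0; apply: le_trans (pb _ _) _.
    rewrite prodr_const card_ord -mulrA -exprMn.
    rewrite [leRHS](_ : _ = C * ((`|h| / rho) ^+ 2 * 2^-1 ^+ k)); last first.
      by rewrite expr_div_n; ring.
    apply: ler_wpM2l => //.
    have q0 : 0 <= (8 * rho)^-1 * `|h| by rewrite mulr_ge0 // invr_ge0 mulr_ge0 // ltW.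
    have h0 : 0 <= `|h| / rho by rewrite divr_ge0 // ltW.
    have qh : (8 * rho)^-1 * `|h| = 8^-1 * (`|h| / rho).
      by field; exact: lt0r_neq0.
    have h1 : `|h| / rho <= 1 by rewrite ler_pdivrMr // mul1r ltW.
    rewrite -[k.+2]addn2 exprD mulrC.
    apply: ler_pM; rewrite ?exprn_ge0 //; apply: lerXn2r; rewrite ?nnegrE //; lra.
  apply: le_trans (geometric_half_le _ _) _.
    by rewrite mulr_ge0 ?exprn_ge0 // divr_ge0 // exprn_ge0 // ltW.
  by rewrite /B mulrA.
move=> eta eta0; exists (Num.min rho (eta / (B + 1))) => [|h].
  by rewrite lt_min r0 divr_gt0 // ltr_wpDl.
rewrite lt_min => /andP[hr he]; apply: le_trans (key h hr) _.
rewrite expr2 mulrA; apply: ler_wpM2r => //.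
move: he; rewrite ltr_pdivlMr ?ltr_wpDl // => he.
by apply: le_trans (ltW he); rewrite mulrC ler_wpM2l // lerDl.
Qed.

End AnalyticEstimates.

(** * Calculus of maps with bounded first and second differences *)

Section C11Theory.
Variable R : realType.
Implicit Types V W Z : normedModType R.

Lemma near_normP V (x : V) (P : V -> Prop) :
  (\forall y \near x, P y) <-> exists2 r : R, 0 < r & forall y, `|y - x| < r -> P y.
Proof.
split=> [/nbhs_ballP[e /= e0 He]|[r r0 Hr]].
  by exists e => // y yx; apply: He; rewrite -ball_normE /= distrC.
by apply/nbhs_ballP; exists r => // y; rewrite -ball_normE /= distrC; exact: Hr.
Qed.

Lemma C11_near V W (f g : V -> W) x :
  (\forall y \near x, f y = g y) -> C11_at f x -> C11_at g x.
Proof.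
move=> /near_normP[e e0 fg] [K [r [K0 r0 f1 f2]]].
exists K, (Num.min r e); split => //; first by rewrite lt_min r0 e0.
- by move=> a b; rewrite !lt_min => /andP[ar ae] /andP[br be]; rewrite -!fg //; exact: f1.
- move=> a s t; rewrite !lt_min => /andP[? ?] /andP[? ?] /andP[? ?] /andP[? ?].
  by rewrite -!fg //; exact: f2.
Qed.

Lemma C11_continuous V W (f : V -> W) x : C11_at f x -> {for x, continuous f}.
Proof.
move=> [K [r [K0 r0 f1 _]]]; apply/cvgrPdist_lt => e e0.
apply/near_normP; exists (Num.min r (e / (K + 1))) => [|y].
  by rewrite lt_min r0 divr_gt0 // ltr_wpDl.
rewrite lt_min ltr_pdivlMr ?ltr_wpDl // => /andP[yr ye].
rewrite distrC; apply: le_lt_trans (f1 _ _ yr _) _; first by rewrite subrr normr0.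
by apply: le_lt_trans ye; rewrite mulrC ler_wpM2l // lerDl.
Qed.

(** The second difference of [g \o f] splits into the second difference of [f], passed through the
    Lipschitz map [g] (at most [L * K]), and the second difference of [g] along the increments [u],
    [v] of [f] (at most [L * K ^+ 2]). *)
Lemma C11_comp V W Z (f : V -> W) (g : W -> Z) x :
  C11_at f x -> C11_at g (f x) -> C11_at (g \o f) x.
Proof.
move=> [K [r [K0 r0 f1 f2]]] [L [e [L0 e0 g1 g2]]].
(* Within radius [d] the values of [f] stay within [e / 4] of [f x], so the point [b + u + v], which
   combines three of them, stays within [e]. *)
pose d := Num.min r (e / (4 * (K + 1))).
have d0 : 0 < d by rewrite lt_min r0 divr_gt0 // mulr_gt0 // ltr_wpDl.
have fd a : `|a - x| < d -> `|a - x| < r /\ `|f a - f x| < e / 4.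
  rewrite lt_min => /andP[ar ae]; split => //.
  apply: le_lt_trans (f1 _ _ ar _) _; first by rewrite subrr normr0.
  have : (K + 1) * `|a - x| < e / 4.
    move: ae; rewrite !ltr_pdivlMr // ?mulr_gt0 ?ltr_wpDl // => ae.
    by rewrite (_ : _ * 4 = `|a - x| * (4 * (K + 1))) //; ring.
  by apply: le_lt_trans; rewrite ler_wpM2r // lerDl.
exists (L * K + L * K ^+ 2), d; split => //.
- by rewrite addr_ge0 ?mulr_ge0 ?exprn_ge0.
- move=> a b /fd[ar ae] /fd[br be] /=.
  apply: le_trans (g1 _ _ _ _) _; try lra.
  apply: (@le_trans _ _ (L * (K * `|a - b|))); first by apply: ler_wpM2l => //; exact: f1.
  by rewrite mulrA ler_wpM2r // lerDl mulr_ge0 ?exprn_ge0.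
- move=> a s t /fd[ar ae] /fd[sr se] /fd[tr te] /fd[str ste] /=.
  set b := f a; pose u := f (a + s) - b; pose v := f (a + t) - b.
  have fs : f (a + s) = b + u by rewrite /u; zmod.
  have ft : f (a + t) = b + v by rewrite /v; zmod.
  have buv : `|b + u + v - f x| < e.
    rewrite /u /v [X in `|X|](_ : _ = (f (a + s) - f x) + (f (a + t) - f x) - (b - f x));
      last by zmod.
    apply: le_lt_trans (ler_normB _ _) _.
    by have := ler_normD (f (a + s) - f x) (f (a + t) - f x); rewrite -/b in ae; lra.
  have Hu : `|u| <= K * `|s|.
    by have := f1 _ _ sr ar; rewrite (_ : a + s - a = s); last by zmod.
  have Hv : `|v| <= K * `|t|.
    by have := f1 _ _ tr ar; rewrite (_ : a + t - a = t); last by zmod.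
  have Hd : `|f (a + s + t) - (b + u + v)| <= K * (`|s| * `|t|).
    rewrite (_ : _ - _ = f (a + s + t) - f (a + s) - f (a + t) + f a); first exact: f2.
    by rewrite /u /v /b; zmod.
  have G2 := g2 b u v; rewrite -fs -ft in G2.
  have {}G2 := G2 ltac:(rewrite /b; lra) ltac:(lra) ltac:(lra) ltac:(rewrite fs; lra).
  have G1 := g1 (f (a + s + t)) (f (a + s) + v) ltac:(lra) ltac:(rewrite fs; lra).
  rewrite (_ : g (f (a + s + t)) - _ - _ + _ = (g (f (a + s + t)) - g (f (a + s) + v)) +
    (g (f (a + s) + v) - g (f (a + s)) - g (f (a + t)) + g b)); last by zmod.
  apply: le_trans (ler_normD _ _) _; rewrite mulrDl; apply: lerD.
    by apply: le_trans G1 _; rewrite -mulrA; apply: ler_wpM2l => //; rewrite fs.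
  apply: le_trans G2 _; rewrite -mulrA; apply: ler_wpM2l => //.
  rewrite (_ : K ^+ 2 * _ = (K * `|s|) * (K * `|t|)); last by ring.
  exact: ler_pM.
Qed.

Lemma C11_lip V W (f : V -> W) x (K : R) : 0 <= K ->
  (forall a b, `|f a - f b| <= K * `|a - b|) ->
  (forall a s t, f (a + s + t) - f (a + s) - f (a + t) + f a = 0) -> C11_at f x.
Proof.
move=> K0 f1 f2; exists K, 1; split => // a s t _ _ _ _.
by rewrite f2 normr0 !mulr_ge0.
Qed.

Lemma C11_shift V (e x : V) : C11_at (fun v => v + e) x.
Proof.
apply: (@C11_lip _ _ _ _ 1) => // [a b|a s t]; last by zmod.
by rewrite mul1r (_ : a + e - (b + e) = a - b) //; zmod.
Qed.

Lemma C11_fst V W (z : V * W) : C11_at (fun v : V * W => v.1) z.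
Proof.
apply: (@C11_lip _ _ _ _ 1) => // [a b|[a1 a2] [s1 s2] [t1 t2]].
  by rewrite mul1r [leRHS]prod_normE /= le_max lexx.
rewrite /= ; zmod.
Qed.

Lemma C11_snd V W (z : V * W) : C11_at (fun v : V * W => v.2) z.
Proof.
apply: (@C11_lip _ _ _ _ 1) => // [a b|[a1 a2] [s1 s2] [t1 t2]].
  by rewrite mul1r [leRHS]prod_normE /= le_max lexx orbT.
rewrite /= ; zmod.
Qed.

Lemma C11_pair V W Z (f : V -> W) (g : V -> Z) x :
  C11_at f x -> C11_at g x -> C11_at (fun v => (f v, g v)) x.
Proof.
move=> [K [r [K0 r0 f1 f2]]] [L [e [L0 e0 g1 g2]]].
exists (Num.max K L), (Num.min r e); split.
- by rewrite le_max K0.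
- by rewrite lt_min r0 e0.
- move=> a b; rewrite !lt_min => /andP[ar ae] /andP[br be].
  rewrite [leLHS]prod_normE /= ge_max; apply/andP; split.
    by apply: le_trans (f1 _ _ _ _) _ => //; rewrite ler_wpM2r // le_max lexx.
  by apply: le_trans (g1 _ _ _ _) _ => //; rewrite ler_wpM2r // le_max lexx orbT.
- move=> a s t; rewrite !lt_min => /andP[? ?] /andP[? ?] /andP[? ?] /andP[? ?].
  rewrite [leLHS]prod_normE /= ge_max; apply/andP; split.
    by apply: le_trans (f2 _ _ _ _ _ _ _) _ => //; rewrite ler_wpM2r ?mulr_ge0 // le_max lexx.
  by apply: le_trans (g2 _ _ _ _ _ _ _) _ => //; rewrite ler_wpM2r ?mulr_ge0 // le_max lexx orbT.
Qed.

End C11Theory.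

(** * Frechet derivatives *)

Section FrechetTheory.
Variable R : realType.
Implicit Types V W Z : normedModType R.

Lemma fderiv_near V W (f g : V -> W) x L :
  (\forall y \near x, f y = g y) -> fderiv f x L -> fderiv g x L.
Proof.
move=> /near_normP[e e0 fg] [Ll Lb fL]; split => // eta /fL[d d0 Hd].
exists (Num.min d e) => [|h]; first by rewrite lt_min d0 e0.
rewrite lt_min => /andP[hd he]; rewrite -!fg ?subrr ?normr0 //; first exact: Hd.
by rewrite (_ : x + h - x = h) //; zmod.
Qed.

Lemma fderiv_lip V W (f : V -> W) x L : fderiv f x L ->
  exists B r : R, [/\ 0 <= B, 0 < r & forall h, `|h| < r -> `|f (x + h) - f x| <= B * `|h|].
Proof.
move=> [_ [B B0 LB] /(_ 1 ltr01)[d d0 Hd]]; exists (B + 1), d; split => //.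
  by rewrite addr_ge0.
move=> h /Hd; rewrite mul1r => H; rewrite mulrDl mul1r.
have := ler_normD (f (x + h) - f x - L h) (L h); rewrite subrK.
by have := LB h; lra.
Qed.

Lemma fderiv_comp V W Z (f : V -> W) (g : W -> Z) x L M :
  fderiv f x L -> fderiv g (f x) M -> fderiv (g \o f) x (M \o L).
Proof.
move=> fL gM; have [C [r [C0 r0 fC]]] := fderiv_lip fL.
move: fL gM => [Ll [B B0 LB] fL] [Ml [D D0 MD] gM]; split.
- by move=> a u v /=; rewrite Ll Ml.
- exists (D * B); first exact: mulr_ge0.
  by move=> v /=; apply: le_trans (MD _) _; rewrite -mulrA ler_wpM2l.
move=> eta eta0.
have [d1 d10 H1] := fL (eta / (2 * (D + 1))) ltac:(by rewrite divr_gt0 // mulr_gt0 // ltr_wpDl).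
have [d2 d20 H2] := gM (eta / (2 * (C + 1))) ltac:(by rewrite divr_gt0 // mulr_gt0 // ltr_wpDl).
exists (Num.min r (Num.min d1 (d2 / (C + 1)))) => [|h].
  by rewrite !lt_min r0 d10 divr_gt0 // ltr_wpDl.
rewrite !lt_min => /and3P[hr h1]; rewrite ltr_pdivlMr ?ltr_wpDl // => h2 /=.
pose k := f (x + h) - f x.
have Hk : `|k| <= C * `|h| by exact: fC.
have kd : `|k| < d2.
  apply: le_lt_trans Hk _; apply: le_lt_trans h2.
  by rewrite mulrC ler_wpM2l // lerDl.
have := H2 k kd; rewrite (_ : f x + k = f (x + h)); last by rewrite /k; zmod.
have MB (u v : W) : M (u - v) = M u - M v.
  by have := Ml (-1) v u; rewrite !scaleN1r addrC => ->; rewrite addrC.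
set gk := g (f (x + h)) - g (f x) => G.
have F := H1 h h1.
rewrite (_ : gk - M (L h) = (gk - M k) + M (k - L h)); last by rewrite MB; zmod.
apply: le_trans (ler_normD _ _) _.
have e1 : `|gk - M k| <= eta / 2 * `|h|.
  apply: le_trans G _; apply: (@le_trans _ _ (eta / (2 * (C + 1)) * ((C + 1) * `|h|))).
    apply: ler_wpM2l; first by rewrite divr_ge0 ?(ltW eta0) // mulr_ge0 // addr_ge0.
    by apply: le_trans Hk _; rewrite ler_wpM2r // lerDl.
  by apply: eq_ler; field; rewrite lt0r_neq0 // ltr_wpDl.
have e2 : `|M (k - L h)| <= eta / 2 * `|h|.
  apply: le_trans (MD _) _.
  apply: (@le_trans _ _ ((D + 1) * (eta / (2 * (D + 1)) * `|h|))).
    apply: ler_pM => //; by rewrite lerDl.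
  by apply: eq_ler; field; rewrite lt0r_neq0 // ltr_wpDl.
by rewrite (_ : eta * `|h| = eta / 2 * `|h| + eta / 2 * `|h|); [exact: lerD|field].
Qed.

Lemma fderiv_shift V (e x : V) : fderiv (fun v => v + e) x id.
Proof.
split=> //; first by exists 1 => // v; rewrite mul1r.
move=> eta eta0; exists 1 => // h _; rewrite (_ : _ - _ - _ = 0); last by zmod.
by rewrite normr0 mulr_ge0 // ltW.
Qed.

Lemma fderiv_pair_cst V W (w : V) (x : W) :
  fderiv (fun v => (w, v)) x (fun v => (0, v)).
Proof.
split.
- by move=> a u v; congr (_, _); rewrite /= scaler0 addr0.
- by exists 1 => // v; rewrite mul1r prod_normE /= normr0 ge_max normr_ge0 lexx.
move=> eta eta0; exists 1 => // h _; rewrite (_ : _ - _ - _ = 0).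
  by rewrite normr0 mulr_ge0 // ltW.
by congr (_, _) => /=; zmod.
Qed.

Lemma fderiv_cst_pair V W (w : V) (x : W) :
  fderiv (fun v => (v, w)) x (fun v => (v, 0)).
Proof.
split.
- by move=> a u v; congr (_, _); rewrite /= scaler0 addr0.
- by exists 1 => // v; rewrite mul1r prod_normE /= normr0 ge_max normr_ge0 lexx.
move=> eta eta0; exists 1 => // h _; rewrite (_ : _ - _ - _ = 0).
  by rewrite normr0 mulr_ge0 // ltW.
by congr (_, _) => /=; zmod.
Qed.

Lemma fderiv_diff V W (f : V -> W) x L : fderiv f x L -> 'd f x = L :> (V -> W).
Proof.
move=> [Ll [B B0 LB] H].
pose Llin := GRing.isLinear.Build R V W _ L Ll.
pose L' : {linear V -> W} := HB.pack L Llin.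
apply: (@diff_unique _ _ _ _ L').
  apply: bounded_linear_continuous.
  apply/linear_boundedP; exists B; split; first exact: num_real.
  by move=> r Br v; apply: le_trans (LB v) _; rewrite ler_wpM2r // ltW.
apply/eqaddoP => eta eta0.
have [d d0 Hd] := H _ eta0.
apply/near_normP; exists d => // h; rewrite subr0 => /Hd.
by rewrite !fctE /= (addrC h x) opprD addrA.
Qed.

End FrechetTheory.

Section LinMap.
Variables (R : realType) (V W : normedModType R).

Definition lin_map (A : V -> W) := forall (a : R) u v, A (a *: u + v) = a *: A u + A v.

Variable A : V -> W.
Hypothesis Alin : lin_map A.

Lemma lin_mapD u v : A (u + v) = A u + A v.
Proof. by have := Alin 1 u v; rewrite !scale1r. Qed.

Lemma lin_map0 : A 0 = 0.
Proof. by apply: (addrI (A 0)); rewrite -lin_mapD !addr0. Qed.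

Lemma lin_mapZ a u : A (a *: u) = a *: A u.
Proof. by have := Alin a u 0; rewrite lin_map0 !addr0. Qed.

Lemma lin_mapN u : A (- u) = - A u.
Proof. by rewrite -scaleN1r lin_mapZ scaleN1r. Qed.

Lemma lin_mapB u v : A (u - v) = A u - A v.
Proof. by rewrite lin_mapD lin_mapN. Qed.

Lemma lin_map_sum I (s : seq I) (f : I -> V) :
  A (\sum_(i <- s) f i) = \sum_(i <- s) A (f i).
Proof.
by elim: s => [|i s IH]; rewrite ?big_nil ?lin_map0 // !big_cons lin_mapD IH.
Qed.

End LinMap.

(* [ch] parametrizes a neighborhood of 1 by the ball of radius [r], [mu] and [nu]
   are the product and the inverse in these coordinates, and [G] is the slice
   [q = 0]. *)
Record local_group_chart (R : realType) (U : groupType) (E : normedModType R)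
    (G : set U) (ch : E -> U) (mu : E -> E -> E) (nu q : E -> E) (r K : R) : Prop :=
  LocalGroupChart {
  lgc_r_gt0 : 0 < r ;
  lgc_K_ge1 : 1 <= K ;
  lgc_Kr_le : 4 * (K * r) <= 1 ;
  lgc_ch0 : ch 0 = 1%g ;
  lgc_ch_inj : forall x y, `|x| < r -> `|y| < r -> ch x = ch y -> x = y ;
  lgc_chM : forall x y, `|x| < r -> `|y| < r -> (ch x * ch y)%g = ch (mu x y) ;
  lgc_chV : forall x, `|x| < r -> (ch x)^-1%g = ch (nu x) ;
  lgc_nu_le : forall x, `|x| < r -> `|nu x| <= 2 * `|x| ;
  lgc_mux0 : forall x, `|x| < r -> mu x 0 = x ;
  lgc_mu_r : forall x y z, `|x| < r -> `|y| < r -> `|z| < r ->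
  `|mu x z - mu x y - (z - y)| <= K * (`|x| * `|z - y|) ;
  lgc_mu_l : forall x y z, `|x| < r -> `|y| < r -> `|z| < r ->
  `|mu z x - mu y x - (z - y)| <= K * (`|x| * `|z - y|) ;
  lgc_qlin : lin_map q ;
  lgc_q_le : forall v, `|q v| <= K * `|v| ;
  lgc_qK : forall v, q (q v) = q v ;
  lgc_G_group : subgroup G ;
  lgc_GE : forall v, `|v| < r -> G (ch v) <-> q v = 0
}.

(** * Arithmetic of the group in a chart around 1 *)

Section LocalGroup.
Variables (R : realType) (U : groupType) (E : completeNormedModType R) (G : set U).
Variables (ch : E -> U) (mu : E -> E -> E) (nu : E -> E) (q : E -> E) (r K : R).
Hypothesis chart_ok : local_group_chart G ch mu nu q r K.

Let r_gt0 : 0 < r.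
Proof. exact: (lgc_r_gt0 chart_ok). Qed.
Let K_ge1 : 1 <= K.
Proof. exact: (lgc_K_ge1 chart_ok). Qed.
Let Kr_le : 4 * (K * r) <= 1.
Proof. exact: (lgc_Kr_le chart_ok). Qed.
Let ch0 : ch 0 = 1%g.
Proof. exact: (lgc_ch0 chart_ok). Qed.
Let ch_inj : forall x y, `|x| < r -> `|y| < r -> ch x = ch y -> x = y.
Proof. exact: (lgc_ch_inj chart_ok). Qed.
Let chM : forall x y, `|x| < r -> `|y| < r -> (ch x * ch y)%g = ch (mu x y).
Proof. exact: (lgc_chM chart_ok). Qed.
Let chV : forall x, `|x| < r -> (ch x)^-1%g = ch (nu x).
Proof. exact: (lgc_chV chart_ok). Qed.
Let nu_le : forall x, `|x| < r -> `|nu x| <= 2 * `|x|.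
Proof. exact: (lgc_nu_le chart_ok). Qed.
Let mux0 : forall x, `|x| < r -> mu x 0 = x.
Proof. exact: (lgc_mux0 chart_ok). Qed.
Let mu_r : forall x y z, `|x| < r -> `|y| < r -> `|z| < r ->
  `|mu x z - mu x y - (z - y)| <= K * (`|x| * `|z - y|).
Proof. exact: (lgc_mu_r chart_ok). Qed.
Let mu_l : forall x y z, `|x| < r -> `|y| < r -> `|z| < r ->
  `|mu z x - mu y x - (z - y)| <= K * (`|x| * `|z - y|).
Proof. exact: (lgc_mu_l chart_ok). Qed.
Let qlin : lin_map q.
Proof. exact: (lgc_qlin chart_ok). Qed.
Let q_le : forall v, `|q v| <= K * `|v|.
Proof. exact: (lgc_q_le chart_ok). Qed.
Let qK : forall v, q (q v) = q v.
Proof. exact: (lgc_qK chart_ok). Qed.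
Let G_group : subgroup G.
Proof. exact: (lgc_G_group chart_ok). Qed.
Let GE : forall v, `|v| < r -> G (ch v) <-> q v = 0.
Proof. exact: (lgc_GE chart_ok). Qed.

(* Conjugation by [g], read in the chart, has at 0 a derivative of norm at most [C]. *)
Definition Ad_le (C : R) (g : U) := exists A : E -> E,
  [/\ lin_map A, forall v, `|A v| <= C * `|v|
    & forall eta : R, 0 < eta -> exists2 d, 0 < d & forall v, `|v| < d ->
      exists2 w, (g * ch v * g^-1)%g = ch w & `|w - A v| <= eta * `|v|].

Hypothesis Ad_bounded_all : forall g, exists C, Ad_le C g.

Let K_ge0 : 0 <= K. Proof. by apply: le_trans K_ge1. Qed.

Let r_le : r <= 4^-1.
Proof.
have := Kr_le; have := @ler_wpM2r _ r (ltW r_gt0) 1 K K_ge1; lra.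
Qed.

Let norm0_lt : `|0 : E| < r. Proof. by rewrite normr0. Qed.

Lemma muE x y : `|x| < r -> `|y| < r -> `|mu x y - (x + y)| <= K * (`|x| * `|y|).
Proof.
move=> xr yr; have := mu_r xr norm0_lt yr; rewrite mux0 // subr0.
by rewrite (_ : mu x y - x - y = mu x y - (x + y)); [exact|zmod].
Qed.

(** This is where [4 * (K * r) <= 1] enters: inside the ball a quadratic error is at most a quarter
    of the linear term, so [mu] is Lipschitz with constant 2 in each variable. *)
Lemma K_mul_le (x : E) (y : R) : `|x| < r -> 0 <= y -> K * (`|x| * y) <= 4^-1 * y.
Proof.
move=> xr y0; rewrite mulrA; apply: ler_wpM2r => //.
have := ler_wpM2l K_ge0 (ltW xr); have := Kr_le; lra.
Qed.

Lemma mu_lip_r x y z : `|x| < r -> `|y| < r -> `|z| < r ->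
  `|mu x z - mu x y| <= 2 * `|z - y|.
Proof.
move=> xr yr zr; have := mu_r xr yr zr; have := K_mul_le xr (normr_ge0 (z - y)).
have := ler_normD (mu x z - mu x y - (z - y)) (z - y); rewrite subrK.
by have := normr_ge0 (z - y); lra.
Qed.

Lemma mu_lip_l x y z : `|x| < r -> `|y| < r -> `|z| < r ->
  `|mu z x - mu y x| <= 2 * `|z - y|.
Proof.
move=> xr yr zr; have := mu_l xr yr zr; have := K_mul_le xr (normr_ge0 (z - y)).
have := ler_normD (mu z x - mu y x - (z - y)) (z - y); rewrite subrK.
by have := normr_ge0 (z - y); lra.
Qed.

Lemma mu_le x y : `|x| < r -> `|y| < r -> `|mu x y| <= `|x| + 2 * `|y|.
Proof.
move=> xr yr; have := mu_lip_r xr norm0_lt yr; rewrite mux0 // subr0.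
by have := ler_normD (mu x y - x) x; rewrite subrK; lra.
Qed.

(** Injectivity of [ch] applies only if the product itself lies in the ball. By [mu_le] the products
    of [x] and [nu x] have norm at most [4 * |x|] and [5 * |x|] in the two orders, whence the factor
    5 here and in [mu_nur]. *)
Lemma mu_nul x : 5 * `|x| < r -> mu (nu x) x = 0.
Proof.
move=> xr; have x0 := normr_ge0 x; have nx := @nu_le x ltac:(lra).
apply: ch_inj; rewrite ?normr0 //.
  by apply: le_lt_trans (mu_le _ _) _; lra.
by rewrite -chM; [rewrite -chV ?mulVg ?ch0; [|lra]|lra|lra].
Qed.

Lemma mu_nur x : 5 * `|x| < r -> mu x (nu x) = 0.
Proof.
move=> xr; have x0 := normr_ge0 x; have nx := @nu_le x ltac:(lra).
apply: ch_inj; rewrite ?normr0 //.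
  by apply: le_lt_trans (mu_le _ _) _; lra.
by rewrite -chM; [rewrite -chV ?mulgV ?ch0; [|lra]|lra|lra].
Qed.

Lemma nuE x : 5 * `|x| < r -> `|nu x + x| <= 2 * K * `|x| ^+ 2.
Proof.
move=> xr; have x0 := normr_ge0 x; have nx := @nu_le x ltac:(lra).
have := @muE x (nu x) ltac:(lra) ltac:(lra); rewrite mu_nur // sub0r normrN addrC.
move=> /le_trans; apply; rewrite (_ : 2 * K * _ = K * (`|x| * (2 * `|x|))); last by ring.
by apply: ler_wpM2l => //; apply: ler_wpM2l.
Qed.

Lemma Ad_le_mul (C C' : R) (g g' : U) : 0 <= C ->
  Ad_le C g -> Ad_le C' g' -> Ad_le (C * C') (g * g')%g.
Proof.
move=> C0 [A [Al AC Ag]] [A' [Al' AC' Ag']].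
have C'0 (v : E) : 0 <= C' * `|v| by apply: le_trans (AC' v); exact: normr_ge0.
exists (A \o A'); split.
- by move=> a u v /=; rewrite Al' Al.
- by move=> v /=; apply: le_trans (AC _) _; rewrite -mulrA ler_wpM2l.
move=> eta eta0; pose D := `|C'| + 1.
have D0 : 0 < D by rewrite ltr_wpDl.
have [d d0 Hd] := Ag (eta / 2 / D) ltac:(by rewrite !divr_gt0).
(* The 1 keeps [w'] within [D * |v|], and the other entry leaves an error of at most half of [eta]
   after [A] is applied. *)
pose eta' := Num.min 1 (eta / 2 / (C + 1)).
have C10 : 0 < C + 1 by rewrite ltr_wpDl.
have [d' d'0 Hd'] := Ag' eta' ltac:(by rewrite lt_min ltr01 !divr_gt0).
exists (Num.min d' (d / D)) => [|v]; first by rewrite lt_min d'0 divr_gt0.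
rewrite lt_min ltr_pdivlMr // => /andP[/Hd'[w' ew' w'A] vd].
have w'D : `|w'| <= D * `|v|.
  have := ler_normD (w' - A' v) (A' v); rewrite subrK.
  have : eta' * `|v| <= 1 * `|v| by rewrite ler_wpM2r // /eta' ge_min lexx.
  have := AC' v; have : C' * `|v| <= `|C'| * `|v| by rewrite ler_wpM2r // ler_norm.
  by rewrite /D; lra.
have [w ew wA] := Hd w' ltac:(apply: le_lt_trans w'D _; by rewrite mulrC).
exists w; first by rewrite -ew -ew' invgM !mulgA.
rewrite /= (_ : w - A (A' v) = (w - A w') + A (w' - A' v)); last by rewrite lin_mapB //; zmod.
apply: le_trans (ler_normD _ _) _.
rewrite (_ : eta * `|v| = eta / 2 * `|v| + eta / 2 * `|v|); last by field.
apply: lerD.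
  apply: le_trans wA _; apply: (@le_trans _ _ (eta / 2 / D * (D * `|v|))).
    by rewrite ler_wpM2l // !divr_ge0 // ltW.
  by apply: eq_ler; field; exact: lt0r_neq0.
apply: le_trans (AC _) _; apply: (@le_trans _ _ ((C + 1) * (eta / 2 / (C + 1) * `|v|))).
  apply: ler_pM => //; first by rewrite lerDl.
  by apply: le_trans w'A _; rewrite ler_wpM2r // /eta' ge_min lexx orbT.
by apply: eq_ler; field; exact: lt0r_neq0.
Qed.

Lemma Ad_le_mono (C C' : R) g : C <= C' -> Ad_le C g -> Ad_le C' g.
Proof.
move=> CC' [A [Al AC Ag]]; exists A; split => // v.
by apply: le_trans (AC v) _; rewrite ler_wpM2r.
Qed.

Lemma ex_div_lt (a d : R) : 0 <= a -> 0 < d -> exists2 t : R, 0 < t <= 1 & a * t < d.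
Proof.
move=> a0 d0; exists (Num.min 1 (d / (a + 1))).
  by rewrite lt_min ltr01 divr_gt0 ?ltr_wpDl //= ge_min lexx.
have a1 : 0 < a + 1 by rewrite ltr_wpDl.
apply: (@le_lt_trans _ _ (a * (d / (a + 1)))).
  by apply: ler_wpM2l => //; rewrite ge_min lexx orbT.
by rewrite mulrA ltr_pdivrMr // mulrC ltr_pM2l // ltrDl.
Qed.

(* The constant 5 exceeds the bound 4 given by the Lipschitz constants of [mu]. *)
Lemma Ad_le_ball x : 10 * `|x| < r -> Ad_le 5 (ch x).
Proof.
move=> xr; have [C [A [Al AC Ag]]] := Ad_bounded_all (ch x).
exists A; split => // v.
have x0 := normr_ge0 x; have nx := @nu_le x ltac:(lra).
have [d d0 Hd] := Ag 1 ltr01.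
(* As [A] is linear, its norm can be tested on a small multiple of [v], where the conjugate is
   computed by [mu]. *)
have [t /andP[t0 t1] tv] := @ex_div_lt `|v| (Num.min d (r / 10 / (`|C| + 1))) (normr_ge0 v)
  ltac:(by rewrite lt_min d0 !divr_gt0 // ltr_wpDl).
have tvE : `|t *: v| = `|v| * t by rewrite normrZ gtr0_norm // mulrC.
move: tv; rewrite -tvE lt_min ltr_pdivlMr ?ltr_wpDl // => /andP[vd vr].
have tr : 10 * `|t *: v| < r.
  have := mulr_ge0 (normr_ge0 (t *: v)) (normr_ge0 C); lra.
have tv0 := normr_ge0 (t *: v).
have [w ew wA] := Hd _ vd.
have m1 := @mu_le x (t *: v) ltac:(lra) ltac:(lra).
have wE : w = mu (mu x (t *: v)) (nu x).
  apply: ch_inj.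
  - have := ler_normD (w - A (t *: v)) (A (t *: v)); rewrite subrK.
    have := AC (t *: v).
    have : C * `|t *: v| <= `|C| * `|t *: v| by rewrite ler_wpM2r // ler_norm.
    move: vr; rewrite mulrDr mulr1 mulrC; lra.
  - by apply: le_lt_trans (mu_le _ _) _; lra.
  - by rewrite -ew -chM; [rewrite -chV ?chM //|..]; lra.
have w4 : `|w| <= 4 * `|t *: v|.
  have := @mu_lip_l (nu x) x (mu x (t *: v)) ltac:(lra) ltac:(lra) ltac:(lra).
  rewrite -wE mu_nur ?subr0; last lra.
  have := @mu_lip_r x 0 (t *: v) ltac:(lra) ltac:(by rewrite normr0) ltac:(lra).
  by rewrite mux0 ?subr0; lra.
have : `|A (t *: v)| <= 5 * `|t *: v|.
  have := ler_normB w (w - A (t *: v)); rewrite (_ : w - (w - A (t *: v)) = A (t *: v)); last by zmod.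
  by lra.
rewrite lin_mapZ // !normrZ gtr0_norm // mulrCA ler_pM2l //.
Qed.

(** * Conjugation is linear up to a uniform quadratic error *)

Section Subdivision.
Variables (C : R) (g : U) (A : E -> E).
Hypothesis C_ge0 : 0 <= C.
Hypothesis Al : lin_map A.
Hypothesis AC : forall v, `|A v| <= C * `|v|.
(** [C] bounds the linear part of an image; the extra 3 leaves room for the errors, so that every
    intermediate image has norm at most [D * s]. *)
Let D := C + 3.
Variables (eta d : R).
Hypothesis eta01 : 0 < eta <= 1.
Hypothesis Ad_d : forall v, `|v| < d ->
  exists2 w, (g * ch v * g^-1)%g = ch w & `|w - A v| <= eta * `|v|.

(* [ch v] is the product of the [N] increments [ch e] between consecutive points
   [k / N *: v], so conjugation by [g] can be followed step by step even though
   the size of the domain of [Ad_d] depends on [g]. *)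
Lemma conj_subdivision (v : E) (N k : nat) :
  `|v| < r / (16 * D ^+ 2) -> (0 < N)%N -> (k <= N)%N ->
  2 * (N%:R^-1 * `|v|) < d ->
  exists2 w, (g * ch ((k%:R / N%:R) *: v) * g^-1)%g = ch w &
    `|w - A ((k%:R / N%:R) *: v)| <=
      k%:R / N%:R * (2 * eta * `|v| + 4 * K * D ^+ 2 * `|v| ^+ 2).
Proof.
move: eta01 => /andP[eta0 eta1]; have D3 : 3 <= D by rewrite /D lerDr.
set s := `|v|; have s0 : 0 <= s by exact: normr_ge0.
have D2 : 9 <= D ^+ 2 by rewrite expr2; have := ler_pM _ _ D3 D3; lra.
rewrite ltr_pdivlMr; last lra.
move=> sD N0.
have N0' : 0 < N%:R :> R by rewrite ltr0n.
set t := N%:R^-1; have t0 : 0 < t by rewrite invr_gt0.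
have t1 : t <= 1 by rewrite invf_le1 // ler1n.
have Nt : N%:R * t = 1 by rewrite mulfV // lt0r_neq0.
set B := 2 * eta * s + _.
(* The radius [r / (16 * D ^+ 2)] is chosen for this: together with [4 * (K * r) <= 1] it makes all
   relative errors at most [1 / 64]. *)
have KDs : 64 * (K * D ^+ 2 * s) <= 1.
  have := ler_wpM2l K_ge0 (ltW sD); have := Kr_le.
  rewrite (_ : K * (s * (16 * D ^+ 2)) = 16 * (K * D ^+ 2 * s)); last by ring.
  lra.
have DDs : 3 * (D * s) <= D ^+ 2 * s.
  by rewrite expr2 -mulrA ler_wpM2r // mulr_ge0 //; lra.
have Ds0 : 3 * s <= D * s by rewrite ler_wpM2r.
have Bs : B <= (2 + 16^-1) * s.
  rewrite /B; have : eta * s <= s by rewrite -[leRHS]mul1r ler_wpM2r.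
  rewrite (_ : 4 * K * D ^+ 2 * s ^+ 2 = 4 * (K * D ^+ 2 * s) * s); last by ring.
  have := ler_wpM2r s0 KDs; rewrite mul1r; lra.
have B0 : 0 <= B.
  by rewrite /B addr_ge0 // !mulr_ge0 ?exprn_ge0 //; lra.
have Ks : 576 * (K * s) <= 1.
  apply: le_trans KDs; rewrite mulrAC (_ : 576 * (K * s) = 64 * (K * s * 9)); last by ring.
  by rewrite ler_wpM2l // ler_wpM2l // mulr_ge0.
elim: k => [_ _|k IH kN std].
  exists 0; last by rewrite !mul0r scale0r lin_map0 // subrr normr0.
  by rewrite mul0r scale0r ch0 mulg1 mulgV.
have [w ew wA] := IH (ltnW kN) std.
set x := (k%:R * t) *: v in ew wA *.
set y := (k.+1%:R * t) *: v.
have kt1 : k%:R * t <= 1.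
  by rewrite -[leRHS]Nt ler_wpM2r ?(ltW t0)// ler_nat ltnW.
have kt0 : 0 <= k%:R * t by rewrite mulr_ge0 // ltW.
have k1t1 : k.+1%:R * t <= 1 by rewrite -[leRHS]Nt ler_wpM2r ?(ltW t0)// ler_nat.
have k1t0 : 0 <= k.+1%:R * t by rewrite mulr_ge0 // ltW.
have xs : `|x| <= s by rewrite normrZ ger0_norm // -[leRHS]mul1r ler_wpM2r.
have ys : `|y| <= s by rewrite normrZ ger0_norm // -[leRHS]mul1r ler_wpM2r.
have yx : y - x = t *: v.
  by rewrite /y /x -scalerBl -mulrBl -natrB // subSnn mul1r.
have sr : 5 * s < r by lra.
have x5 : 5 * `|x| < r by lra.
have x0 := normr_ge0 x.
have xr : `|x| < r by lra.
have yr : `|y| < r by lra.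
have nx := nu_le xr.
have nxr : `|nu x| < r by lra.
pose e := mu (nu x) y.
(* Since [mu (nu x) x = 0], the deviation of the increment from [t *: v] carries the factor [t], so
   that [N] of them add up to a quadratic error only. *)
have eE : `|e - t *: v| <= 2 * (K * s) * (t * s).
  have := mu_r nxr xr yr; rewrite mu_nul //.
  rewrite subr0 yx normrZ (gtr0_norm t0) -/s => /le_trans; apply.
  rewrite (_ : 2 * (K * s) * (t * s) = K * ((2 * s) * (t * s))); last by ring.
  apply: ler_wpM2l => //; apply: ler_wpM2r; last lra.
  by rewrite mulr_ge0 // ltW.
have ts0 : 0 <= t * s by rewrite mulr_ge0 // ltW.
have tss : t * s <= s by rewrite -[leRHS]mul1r ler_wpM2r.
have ee : `|e| <= 2 * (t * s).
  have := ler_normD (e - t *: v) (t *: v); rewrite subrK.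
  rewrite normrZ (gtr0_norm t0) -/s.
  have : K * s * (t * s) <= 576^-1 * (t * s) by rewrite ler_wpM2r //; lra.
  lra.
have [z ez zA] := Ad_d (le_lt_trans ee std).
have Ae : `|A e - t *: A v| <= C * (2 * (K * s) * (t * s)).
  rewrite -lin_mapZ // -lin_mapB //; apply: le_trans (AC _) _.
  exact: ler_wpM2l.
have Cs : `|A e| <= C * (2 * (t * s)) by apply: le_trans (AC _) _; apply: ler_wpM2l.
have etae : eta * `|e| <= eta * (2 * (t * s)) by rewrite ler_wpM2l // ltW.
have etats : eta * (t * s) <= t * s by rewrite -[leRHS]mul1r ler_wpM2r.
have zz : `|z| <= 2 * (D * (t * s)).
  have := ler_normD (z - A e) (A e); rewrite subrK.
  by rewrite /D; lra.
have ww : `|w| <= D * s.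
  have := ler_normD (w - A x) (A x); rewrite subrK.
  have : C * `|x| <= C * s by rewrite ler_wpM2l.
  have : k%:R * t * B <= B by rewrite -[leRHS]mul1r ler_wpM2r.
  have := AC x; rewrite /D; lra.
have Dts : D * (t * s) <= D * s by rewrite ler_wpM2l //; lra.
have wr : `|w| < r by lra.
have zr : `|z| < r by lra.
exists (mu w z).
  rewrite -chM // -ew -ez.
  have -> : ch y = (ch x * ch e)%g.
    by rewrite /e -chM // -chV // mulVKg.
  by rewrite !mulgA mulgVK.
have wz := muE wr zr.
(* The four errors are the nonlinearity of the product, the error inherited from step [k], that of
   conjugating the increment, and the deviation of the increment from [t *: v]. All but the
   inherited one are proportional to [t] and together make up [t * B]. *)
have -> : mu w z - A y = (mu w z - (w + z)) + (w - A x) + (z - A e) + (A e - t *: A v).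
  have -> : y = x + t *: v by rewrite -yx; zmod.
  have -> : A (x + t *: v) = A x + t *: A v by rewrite (lin_mapD Al) (lin_mapZ Al t).
  zmod.
have H1 : K * (`|w| * `|z|) <= 2 * (t * (K * D ^+ 2 * s ^+ 2)).
  rewrite (_ : 2 * (t * (K * D ^+ 2 * s ^+ 2)) = K * (D * s * (2 * (D * (t * s))))); last by ring.
  by apply: ler_wpM2l => //; apply: ler_pM.
have H2 : C * (2 * (K * s) * (t * s)) <= 2 * (t * (K * D ^+ 2 * s ^+ 2)).
  rewrite (_ : C * _ = 2 * (t * (K * C * s ^+ 2))); last by ring.
  rewrite ler_wpM2l // ler_wpM2l ?(ltW t0) // ler_wpM2r ?exprn_ge0 // ler_wpM2l //.
  have := ler_wpM2r (le_trans (ler0n _ 3) D3) D3; rewrite -expr2 /D.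
  by have := C_ge0; lra.
have -> : k.+1%:R * t * B = k%:R * t * B + t * B.
  by rewrite -natr1; ring.
apply: le_trans (ler_normD _ _) _.
have := ler_normD (mu w z - (w + z) + (w - A x)) (z - A e).
have := ler_normD (mu w z - (w + z)) (w - A x).
have -> : t * B = 2 * (eta * (t * s)) + 4 * (t * (K * D ^+ 2 * s ^+ 2)).
  by rewrite /B; ring.
lra.
Qed.

End Subdivision.

(** In [Ad_le] the range [d] depends on [g] and on the accuracy [eta]; here radius and constant
    depend on [C] alone. Subdivision with [N] adapted to [d] leaves an extra error [2 * eta * |v|],
    and [eta] then tends to 0. *)
Lemma conj_estimate (C : R) (g : U) : 0 <= C -> Ad_le C g ->
  exists A : E -> E, [/\ lin_map A, forall v, `|A v| <= C * `|v|
    & forall v, `|v| < r / (16 * (C + 3) ^+ 2) ->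
      exists2 w, (g * ch v * g^-1)%g = ch w
        & `|w - A v| <= 4 * K * (C + 3) ^+ 2 * `|v| ^+ 2].
Proof.
move=> C0 [A [Al AC Ag]]; exists A; split => // v vr.
have H eta : 0 < eta <= 1 -> exists2 w, (g * ch v * g^-1)%g = ch w &
    `|w - A v| <= 2 * eta * `|v| + 4 * K * (C + 3) ^+ 2 * `|v| ^+ 2.
  move=> eta01; have [d d0 Hd] := Ag eta ltac:(by case/andP: eta01).
  have [t /andP[t0 _] td] := @ex_div_lt (2 * `|v|) d ltac:(by rewrite mulr_ge0) d0.
  pose N := (Num.truncn t^-1).+1.
  have Nt : N%:R^-1 < t.
    by rewrite invf_plt ?posrE ?ltr0n // /N truncnS_gt.
  have := @conj_subdivision C g A C0 Al AC eta d eta01 Hd v N N vr isT (leqnn _).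
  rewrite divff ?scale1r ?mul1r ?pnatr_eq0 //; apply.
  apply: le_lt_trans td; rewrite mulrCA mulrC ler_wpM2l ?mulr_ge0 // ltW //.
have D2 : 9 <= (C + 3) ^+ 2.
  by have := @ler_pM _ 3 (C + 3) 3 (C + 3) ltac:(lra) ltac:(lra) ltac:(lra) ltac:(lra); rewrite expr2; lra.
have vD : 16 * ((C + 3) ^+ 2 * `|v|) < r.
  by move: vr; rewrite ltr_pdivlMr ?mulrA 1?mulrC // ?mulrA; lra.
have small w eta : 0 < eta <= 1 ->
    `|w - A v| <= 2 * eta * `|v| + 4 * K * (C + 3) ^+ 2 * `|v| ^+ 2 -> `|w| < r.
  move=> /andP[e0 e1] wA.
  have v0 := normr_ge0 v.
  have e2 : eta * `|v| <= `|v| by rewrite -[leRHS]mul1r ler_wpM2r.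
  have := ler_normD (w - A v) (A v); rewrite subrK; have := AC v.
  have : 64 * (K * (C + 3) ^+ 2 * `|v|) <= 1.
    have := ler_wpM2l K_ge0 (ltW vD); have := Kr_le.
    by rewrite (_ : K * (16 * _) = 16 * (K * (C + 3) ^+ 2 * `|v|)); [lra|ring].
  move=> /(ler_wpM2r v0); rewrite mul1r.
  move: wA; rewrite (_ : 4 * K * _ * _ = 4 * (K * (C + 3) ^+ 2 * `|v| * `|v|)); last by ring.
  have : (C + 3) * `|v| <= (C + 3) ^+ 2 * `|v|.
    apply: ler_wpM2r => //; rewrite expr2 -[leLHS]mul1r; apply: ler_wpM2r; lra.
  have := r_gt0; lra.
have [w ew wA] := H 1 ltac:(by rewrite ltr01 lexx).
exists w => //; apply/ler_addgt0Pr => e e0.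
have [t t01 te] := @ex_div_lt (2 * `|v|) e ltac:(by rewrite mulr_ge0) e0.
have [w' ew' w'A] := H t t01.
(* Injectivity of [ch] makes the image independent of [eta], so a single [w] satisfies all the
   estimates. *)
have -> : w = w'.
  apply: ch_inj; last by rewrite -ew -ew'.
  - by apply: small wA; rewrite ltr01 lexx.
  - exact: small t01 w'A.
apply: le_trans w'A _; rewrite addrC lerD2l.
by apply: ltW; apply: le_lt_trans te; rewrite mulrAC.
Qed.
Lemma norm_sum_seq_le (I : eqType) (s : seq I) (f : I -> E) (B : R) :
  (forall i, i \in s -> `|f i| <= B) -> `|\sum_(i <- s) f i| <= (size s)%:R * B.
Proof.
elim: s => [_|i s IH fB]; first by rewrite big_nil normr0 mul0r.
rewrite big_cons /= -natr1 mulrDl mul1r addrC; apply: le_trans (ler_normD _ _) _.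
apply: lerD; last by apply: fB; rewrite mem_head.
by apply: IH => j js; apply: fB; rewrite in_cons js orbT.
Qed.

(** One constant serves for the linear part and for the quadratic error, so the errors of a Newton
    step are powers of [L] times [eps ^+ 2]. *)
Definition conj_good (L rho : R) (g : U) (A : E -> E) :=
  [/\ lin_map A, forall v, `|A v| <= L * `|v|
    & forall v, `|v| < rho -> exists2 w, (g * ch v * g^-1)%g = ch w
        & `|w - A v| <= L * `|v| ^+ 2].

(** * One Newton step *)

Section Step.
Variables (L rho eps : R).
Hypothesis KL : K <= L.
Hypothesis eps_gt0 : 0 < eps.
(** The factor 128 keeps all intermediate points in the ball; the most demanding one is [p] in
    [split_residual], which needs [5 * 22]. *)
Hypothesis eps_r : 128 * (L ^+ 2 * eps) < r.
Hypothesis eps_rho : 2 * eps < rho.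

Let L_ge1 : 1 <= L. Proof. exact: le_trans KL. Qed.

Let Leps : eps <= L * eps <= L ^+ 2 * eps.
Proof.
have e0 := ltW eps_gt0; have L1 := L_ge1.
have H : eps <= L * eps by rewrite -[leLHS]mul1r ler_wpM2r.
rewrite H expr2 -mulrA -[leLHS]mul1r ler_wpM2r //; apply: le_trans H => //.
Qed.

Let L2eps_le1 : 512 * (L ^+ 2 * eps) <= 1.
Proof. have := eps_r; have := r_le; lra. Qed.

Let eps2_le : eps ^+ 2 <= L * eps ^+ 2 <= L ^+ 2 * eps ^+ 2.
Proof.
have /andP[h1 h2] := Leps; have e0 := ltW eps_gt0.
have := ler_wpM2r e0 h1; have := ler_wpM2r e0 h2.
by rewrite -!mulrA -!expr2 => -> ->.
Qed.

(** Moving [g] to the front turns the conjugate into [g] times the product of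
    [g^-1 * (ch y)^-1 * g], [ch w] and [ch y], whose coordinates are nearly [- A y], [w] and [y].
    This is why [A] is the derivative for [g^-1]. *)
Lemma conj_residual g w y A : conj_good L rho g^-1 A ->
  `|w| <= eps -> `|y| <= eps ->
  exists2 t, ((ch y)^-1 * (g * ch w) * ch y)%g = (g * ch t)%g &
    `|t - (w + y - A y)| <= 22 * (L ^+ 2 * eps ^+ 2) /\ `|t| <= 11 * (L * eps).
Proof.
move=> [Al AL Ag] we ye.
have /andP[l1 l2] := Leps; have /andP[m1 m2] := eps2_le.
have e0 := eps_gt0; have eps_r' := eps_r; have LL := L_ge1; have L2e := L2eps_le1.
have y0 := normr_ge0 y; have w0 := normr_ge0 w; have rho_eps := eps_rho.
have ny := @nu_le y ltac:(lra).
have [z] := Ag (nu y) ltac:(lra); rewrite invgK => ez zA.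
have y2 : `|y| ^+ 2 <= eps ^+ 2 by rewrite lerXn2r ?nnegrE // ltW.
have ny2 : `|nu y| ^+ 2 <= 4 * eps ^+ 2.
  rewrite (_ : 4 * _ = (2 * eps) ^+ 2); last by ring.
  by rewrite lerXn2r ?nnegrE //; lra.
have nyy : `|nu y + y| <= 2 * (L * eps ^+ 2).
  apply: le_trans (nuE _) _; first lra.
  rewrite -mulrA ler_wpM2l //; apply: ler_pM => //; exact: exprn_ge0.
have L0 : 0 <= L by lra.
have Az : `|z + A y| <= 6 * (L ^+ 2 * eps ^+ 2).
  have -> : z + A y = (z - A (nu y)) + A (nu y + y) by rewrite (lin_mapD Al); zmod.
  apply: le_trans (ler_normD _ _) _.
  have := ler_wpM2l L0 ny2; have := AL (nu y + y); have := ler_wpM2l L0 nyy.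
  rewrite (_ : L * (2 * (L * eps ^+ 2)) = 2 * (L ^+ 2 * eps ^+ 2)); last by ring.
  by lra.
have e2 : 512 * (L ^+ 2 * eps ^+ 2) <= eps.
  by have := ler_wpM2r (ltW e0) L2e; rewrite mul1r expr2 !mulrA.
have Ay : `|A y| <= L * eps by apply: le_trans (AL _) _; exact: ler_wpM2l.
have zz : `|z| <= 2 * (L * eps).
  by have := ler_normB (z + A y) (A y); rewrite addrK; lra.
have zr : `|z| < r by lra.
have wr : `|w| < r by lra.
have yr : `|y| < r by lra.
have mzw := mu_le zr wr.
have mr : `|mu z w| < r by lra.
have E1 := muE zr wr; have E2 := muE mr yr.
exists (mu (mu z w) y).
  by rewrite -chM // -chM // -ez (chV yr) !mulgA mulgV mul1g.
split; last by apply: le_trans (mu_le mr yr) _; lra.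
have -> : mu (mu z w) y - (w + y - A y) =
  (mu (mu z w) y - (mu z w + y)) + (mu z w - (z + w)) + (z + A y) by zmod.
apply: le_trans (ler_normD _ _) _.
have := ler_normD (mu (mu z w) y - (mu z w + y)) (mu z w - (z + w)).
have K1 : K * (`|z| * `|w|) <= 2 * (L ^+ 2 * eps ^+ 2).
  rewrite (_ : 2 * _ = L * (2 * (L * eps) * eps)); last by ring.
  by apply: ler_pM => //; apply: ler_pM.
have K2 : K * (`|mu z w| * `|y|) <= 4 * (L ^+ 2 * eps ^+ 2).
  rewrite (_ : 4 * _ = L * (4 * (L * eps) * eps)); last by ring.
  by apply: ler_pM => //; apply: ler_pM => //; lra.
have X0 : 0 <= eps ^+ 2 by rewrite exprn_ge0 // ltW.
lra.
Qed.

(* Taking residuals modulo [ker q] turns the product of [h] and [k] into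
   an additive cocycle relation. *)
Lemma cocycle_residual h k g1 g2 g3 w1 w2 w3 A : G g1 -> G g2 -> G g3 ->
  h = (g1 * ch w1)%g -> k = (g2 * ch w2)%g -> (h * k)%g = (g3 * ch w3)%g ->
  `|w1| <= eps -> `|w2| <= eps -> `|w3| <= eps ->
  conj_good L rho g2^-1 A ->
  `|q w3 - q (A w1) - q w2| <= 71 * (L ^+ 4 * eps ^+ 2).
Proof.
move=> G1 G2 G3 hE kE hkE w1e w2e w3e [Al AL Ag].
have /andP[l1 l2] := Leps; have /andP[m1 m2] := eps2_le.
have e0 := eps_gt0; have eps_r' := eps_r; have LL := L_ge1; have L2e := L2eps_le1.
have L0 : 0 <= L by lra.
have w10 := normr_ge0 w1; have w20 := normr_ge0 w2; have w30 := normr_ge0 w3.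
have rho_eps := eps_rho.
have [z] := Ag w1 ltac:(lra); rewrite invgK => ez zA.
have w1sq : `|w1| ^+ 2 <= eps ^+ 2 by rewrite lerXn2r ?nnegrE // ltW.
have zAe : `|z - A w1| <= L * eps ^+ 2 by apply: le_trans zA _; exact: ler_wpM2l.
have e2 : 512 * (L ^+ 2 * eps ^+ 2) <= eps.
  by have := ler_wpM2r (ltW e0) L2e; rewrite mul1r expr2 !mulrA.
have zz : `|z| <= 2 * (L * eps).
  have := ler_normD (z - A w1) (A w1); rewrite subrK.
  by have := AL w1; have := ler_wpM2l L0 w1e; lra.
have zr : `|z| < r by lra.
have w2r : `|w2| < r by lra.
have w3r : `|w3| < r by lra.
pose b := mu z w2.
have b_le : `|b| <= 4 * (L * eps) by apply: le_trans (mu_le zr w2r) _; lra.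
have b0 := normr_ge0 b.
have br : `|b| < r by lra.
have nb := nu_le br; have nbr : `|nu b| < r by lra.
(* [s] is the coordinate of [g3^-1 * g1 * g2], the defect of [h |-> g_h] from being a homomorphism.
   It lies in [G], so [q] kills it. *)
pose s := mu w3 (nu b).
have s_le : `|s| <= 17 * (L * eps) by apply: le_trans (mu_le w3r nbr) _; lra.
have sr : `|s| < r by lra.
have chs : ch s = (g3^-1 * g1 * g2)%g.
  rewrite /s -chM // -chV // /b -chM // -ez.
  have -> : ch w3 = (g3^-1 * (h * k))%g by rewrite hkE mulKg.
  by rewrite hE kE !invgM !mulgA !invgK; rewrite !(mulgK, mulgVK).
have [_ GM GV] := G_group.
have qs : q s = 0 by apply/(GE sr); rewrite chs; apply: (GM) => //; apply: (GM) => //; exact: GV.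
have w3E : w3 = mu s b.
  apply: ch_inj => //; first by apply: le_lt_trans (mu_le sr br) _; lra.
  by rewrite -chM // /s -chM // -chV // mulgVK.
have E1 := muE zr w2r; have E2 := muE sr br.
have K1 : K * (`|z| * `|w2|) <= 2 * (L ^+ 2 * eps ^+ 2).
  rewrite (_ : 2 * _ = L * (2 * (L * eps) * eps)); last by ring.
  by apply: ler_pM => //; apply: ler_pM.
have K2 : K * (`|s| * `|b|) <= 68 * (L ^+ 3 * eps ^+ 2).
  rewrite (_ : 68 * _ = L * (17 * (L * eps) * (4 * (L * eps)))); last by ring.
  by apply: ler_pM => //; apply: ler_pM.
have -> : q w3 - q (A w1) - q w2 = q (w3 - (s + (A w1 + w2))).
  by rewrite !(lin_mapD qlin, lin_mapN qlin) qs; zmod.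
apply: le_trans (q_le _) _.
(* 71 is 68 for the product of [s] and [b], 2 for [b] and 1 for [z]; applying [q] costs the fourth
   factor [L]. *)
rewrite (_ : 71 * _ = L * (71 * (L ^+ 3 * eps ^+ 2))); last by ring.
apply: ler_pM => //.
have -> : w3 - (s + (A w1 + w2)) = (mu s b - (s + b)) + (b - (z + w2)) + (z - A w1).
  by rewrite -w3E; zmod.
have L23 : L ^+ 2 * eps ^+ 2 <= L ^+ 3 * eps ^+ 2.
  rewrite (_ : L ^+ 3 * _ = L * (L ^+ 2 * eps ^+ 2)); last by ring.
  by rewrite -[leLHS]mul1r ler_wpM2r // mulr_ge0 ?exprn_ge0 // ltW.
apply: le_trans (ler_normD _ _) _.
have := ler_normD (mu s b - (s + b)) (b - (z + w2)).
rewrite -/b in E1; lra.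
Qed.

(** The part [p] of [t] in the kernel of [q] gives a factor in [G]. What remains is [mu (nu p) t],
    and [mu (nu p)] vanishes at [p] and is 2-Lipschitz, so only [t - p = q t] counts. *)
Lemma split_residual t : `|t| <= 11 * (L * eps) ->
  exists a w, [/\ G a, ch t = (a * ch w)%g & `|w| <= 2 * `|q t|].
Proof.
move=> te.
have /andP[l1 l2] := Leps; have e0 := eps_gt0; have eps_r' := eps_r.
have LL := L_ge1; have L2e := L2eps_le1.
have qt : `|q t| <= 11 * (L ^+ 2 * eps).
  apply: le_trans (q_le _) _; rewrite (_ : 11 * _ = L * (11 * (L * eps))); last by ring.
  exact: ler_pM.
pose p := t - q t.
have pE : `|p| <= 22 * (L ^+ 2 * eps) by apply: le_trans (ler_normB _ _) _; lra.
have pr : 5 * `|p| < r by lra.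
have p0 := normr_ge0 p.
have pr' : `|p| < r by lra.
have tr : `|t| < r by lra.
have np := nu_le pr'; have npr : `|nu p| < r by lra.
exists (ch p), (mu (nu p) t); split.
- by apply/(GE pr'); rewrite /p (lin_mapB qlin) qK subrr.
- by rewrite -chM // -chV // mulVKg.
- have := mu_lip_r npr pr' tr; rewrite mu_nul // subr0 (_ : t - p = q t) //.
  by rewrite /p; zmod.
Qed.

(** With [y = - wbar] the first-order residual of [k] is [w k - wbar + A wbar]. Modulo the kernel of
    [q] this is minus the averaged cocycle relation, hence quadratic, and [split_residual] moves the
    kernel part into [G]. The weight [n^-1] cancels the number of terms, so the order of [H] does
    not enter. *)
Lemma averaging_step (H : set U) : finite_set H -> H 1%g ->
  (forall x y, H x -> H y -> H (x * y)%g) -> (forall x, H x -> H x^-1%g) ->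
  (forall h, H h -> exists g w, [/\ G g, `|w| <= eps & h = (g * ch w)%g]) ->
  (forall h g w, H h -> `|w| <= eps -> h = (g * ch w)%g ->
     exists A, conj_good L rho g^-1 A) ->
  exists2 y, `|y| <= eps & forall h, H h ->
    exists g w, [/\ G g, `|w| <= 186 * (L ^+ 4 * eps ^+ 2)
                 & ((ch y)^-1 * h * ch y)%g = (g * ch w)%g].
Proof.
move=> Hfin H1 HM HV Hres Hgood.
have /choice[gw gwP] : forall h, exists p : U * E,
    H h -> [/\ G p.1, `|p.2| <= eps & h = (p.1 * ch p.2)%g].
  move=> h; have [/Hres[g [w Hw]]|nH] := pselect (H h); first by exists (g, w).
  by exists (1%g, 0).
pose g h := (gw h).1; pose w h := (gw h).2.
pose s : seq U := fset_set H.
have sH h : (h \in s) = (h \in H) by rewrite in_fset_set.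
pose n : R := (size s)%:R.
have n0 : 0 < n.
  by rewrite ltr0n lt0n size_eq0; apply/eqP => s0; have := sH 1%g; rewrite s0 in_nil mem_set.
pose wbar := n^-1 *: \sum_(h <- s) w h.
have wbar_le : `|wbar| <= eps.
  rewrite normrZ gtr0_norm ?invr_gt0 // ler_pdivrMl //.
  by apply: norm_sum_seq_le => h; rewrite sH inE => /gwP[].
exists (- wbar); first by rewrite normrN.
move=> k Hk; have [Gk wk kE] := gwP k Hk.
have [A Akg] := Hgood k (g k) (w k) Hk wk kE.
have [Al _ _] := Akg.
have [t tE [tA te]] := @conj_residual (g k) (w k) (- wbar) A Akg wk ltac:(by rewrite normrN).
have avg : `|q wbar - q (A wbar) - q (w k)| <= 71 * (L ^+ 4 * eps ^+ 2).
  (* Right translation by [k] permutes [H], so the mean of [w (h * k)] is again [wbar]; [A] depends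
     on [k] only and passes through the sum. *)
  have perm_s : perm_eq [seq (h * k)%g | h <- s] s.
    apply: uniq_perm; rewrite ?map_inj_uniq ?fset_uniq //; first exact: mulIg.
    move=> h; rewrite sH; apply/mapP/idP => [[h']|].
      by rewrite sH !inE => Hh' ->; exact: (HM).
    rewrite inE => Hh; exists (h * k^-1)%g; last by rewrite mulgVK.
    by rewrite sH inE; apply: (HM) => //; exact: (HV).
  have -> : q wbar - q (A wbar) - q (w k) =
      n^-1 *: \sum_(h <- s) (q (w (h * k)%g) - q (A (w h)) - q (w k)).
    have Sk : \sum_(h <- s) q (w k) = n *: q (w k).
      rewrite /n big_const_seq count_predT scaler_nat.
      by elim: (size s) => // m /= ->; rewrite mulrS.
    have Shk : \sum_(h <- s) q (w (h * k)%g) = \sum_(h <- s) q (w h).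
      by rewrite -[RHS](perm_big _ perm_s) big_map.
    rewrite !sumrB Sk Shk !scalerBr scalerA mulVf ?lt0r_neq0 // scale1r.
    by rewrite /wbar (lin_mapZ Al) !(lin_mapZ qlin) (lin_map_sum Al) !(lin_map_sum qlin).
  rewrite normrZ gtr0_norm ?invr_gt0 // ler_pdivrMl //.
  apply: norm_sum_seq_le => h; rewrite sH inE => Hh.
  have [Gh wh hE] := gwP h Hh; have [Ghk whk hkE] := gwP _ (HM _ _ Hh Hk).
  exact: cocycle_residual hE kE hkE wh wk whk Akg.
have [a [w' [Ga taw w'le]]] := split_residual te.
have [_ GM _] := G_group.
exists (g k * a)%g, w'; split; first exact: GM.
- apply: le_trans w'le _.
  (* 186 is [2 * (22 + 71)]: the factor 2 of [split_residual], the error of [conj_residual] and that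
     of the averaged cocycle. *)
  have -> : q t = q (t - (w k + - wbar - A (- wbar))) - (q wbar - q (A wbar) - q (w k)).
    by rewrite !(lin_mapD qlin, lin_mapN qlin, lin_mapN Al); zmod.
  have LL := L_ge1.
  have := ler_normB (q (t - (w k + - wbar - A (- wbar)))) (q wbar - q (A wbar) - q (w k)).
  have : `|q (t - (w k + - wbar - A (- wbar)))| <= 22 * (L ^+ 4 * eps ^+ 2).
    apply: le_trans (q_le _) _.
    apply: (@le_trans _ _ (L * (22 * (L ^+ 2 * eps ^+ 2)))); first exact: ler_pM.
    rewrite (_ : L * _ = 22 * (L ^+ 3 * eps ^+ 2)); last by ring.
    by rewrite ler_wpM2l // ler_wpM2r ?exprn_ge0 ?(ltW eps_gt0) // ler_weXn2l.
  lra.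
- by rewrite -[RHS]mulgA -taw -tE -kE.
Qed.

End Step.

(** * Convergence of the iteration *)

Lemma approx_in_G t :
  (forall d, 0 < d -> exists g w, [/\ G g, `|w| <= d & t = (g * ch w)%g]) -> G t.
Proof.
move=> H; have [_ GM GV] := G_group; have r0 := r_gt0.
have [g0 [w0 [Gg0 w0d t0]]] := H (r / 10) ltac:(lra).
have w0r : `|w0| < r by lra.
suff q0 : q w0 = 0 by rewrite t0; apply: (GM) => //; apply/(GE w0r).
have K0 : 0 < K by apply: lt_le_trans K_ge1.
apply/eqP; rewrite -normr_le0; apply/ler_addgt0Pr => d d0; rewrite add0r.
(* A finer decomposition of the same [t] gives [ch w0 * (ch w1)^-1 = g0^-1 * g1] in [G]. Its
   coordinate is killed by [q] and tends to [w0] with [w1]. *)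
have [g1 [w1 [Gg1 w1d t1]]] := H (Num.min (r / 10) (d / (4 * K)))
  ltac:(by rewrite lt_min !divr_gt0 ?mulr_gt0).
move: w1d; rewrite le_min !ler_pdivlMr ?mulr_gt0 // => /andP[w1r' w1d].
have w1r : `|w1| < r by lra.
have nw := nu_le w1r; have w10 := normr_ge0 w1.
have nwr : `|nu w1| < r by lra.
have mr : `|mu w0 (nu w1)| < r by apply: le_lt_trans (mu_le w0r nwr) _; lra.
have qm : q (mu w0 (nu w1)) = 0.
  apply/(GE mr); rewrite -chM // -chV //.
  have -> : (ch w0 * (ch w1)^-1 = g0^-1 * g1)%g.
    by apply: (mulgI g0); rewrite mulgA -t0 t1 mulgK mulVKg.
  by apply: (GM) => //; exact: GV.
have ml := mu_lip_r w0r norm0_lt nwr.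
rewrite mux0 // subr0 in ml.
have -> : q w0 = q (w0 - mu w0 (nu w1)) by rewrite (lin_mapB qlin) qm subr0.
apply: le_trans (q_le _) _; rewrite distrC.
apply: (@le_trans _ _ (K * (4 * `|w1|))); first by apply: ler_wpM2l => //; lra.
by rewrite (_ : K * _ = `|w1| * (4 * K)) //; ring.
Qed.

Lemma ex_half_lt (a d : R) : 0 < d -> exists n : nat, a * 2^-1 ^+ n < d.
Proof.
move=> d0; exists (Num.truncn (a / d)).+1.
rewrite exprVn ltr_pdivrMr ?exprn_gt0 // -ltr_pdivrMl // mulrC.
by apply: lt_le_trans (natr_le_2expn _ _); exact: truncnS_gt.
Qed.

Lemma geometric_cvg (f : nat -> E) (e : R) : 0 <= e ->
  (forall n, `|f n.+1 - f n| <= 2 * (e * 2^-1 ^+ n)) ->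
  exists x, forall n, `|x - f n| <= 4 * (e * 2^-1 ^+ n).
Proof.
move=> e0 fe.
(* The subtracted term makes the induction close: the drop of [4 * (e * 2^-1 ^+ k)] from one [k] to
   the next is exactly the allowed increment. *)
have step n m : `|f (n + m)%N - f n| <= 4 * (e * 2^-1 ^+ n) - 4 * (e * 2^-1 ^+ (n + m)).
  elim: m => [|m IH]; first by rewrite addn0 !subrr normr0.
  rewrite addnS -[X in `|X|](subrKA (f (n + m)%N)).
  apply: le_trans (ler_normD _ _) _; have := fe (n + m)%N.
  by rewrite exprS; lra.
have cf : cvgn f.
  apply/cauchy_cvgP/cauchy_exP => d d0.
  have [n nd] := @ex_half_lt (4 * e) d d0.
  exists (f n), n => // m /= nm; rewrite -ball_normE /= distrC.
  have := step n (m - n)%N; rewrite subnKC // => /le_lt_trans; apply.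
  by have : 0 <= 4 * (e * 2^-1 ^+ m); [rewrite !mulr_ge0 // exprn_ge0|lra].
exists (limn f) => n.
apply: (cvg_norm_le (k := n) (cvgB cf (cvg_cst (f n)))) => m nm /=.
have := step n (m - n)%N; rewrite subnKC // => /le_trans; apply.
by rewrite gerBl !mulr_ge0 // exprn_ge0.
Qed.

Lemma conj_into_G (C : R) : 1 <= C -> exists2 eps, 0 < eps &
  forall H : set U, finite_set H -> subgroup H ->
    (forall h, H h -> Ad_le C h) ->
    (forall h, H h -> exists g w, [/\ G g, `|w| <= eps & h = (g * ch w)%g]) ->
  exists x, forall h, H h -> G (x^-1 * h * x)%g.
Proof.
move=> C1.
(* Conjugating by [ch x] costs a factor 5 on each side, and passing from the conjugate of [h^-1] to
   [g^-1] costs another one; the 3 is that of [conj_estimate]. *)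
have [D DE] : exists D, 5 * (5 * C * 5) + 3 = D by eexists.
have [rho rhoE] : exists rho, r / (16 * D ^+ 2) = rho by eexists.
have [L LE] : exists L, 4 * K * D ^+ 2 = L by eexists.
have D1 : 128 <= D by rewrite -DE; lra.
have DD : D <= D ^+ 2 by rewrite expr2 -[leLHS]mul1r ler_wpM2r //; lra.
have D2L : 4 * D ^+ 2 <= L.
  rewrite -LE mulrAC -[leLHS]mulr1; apply: ler_wpM2l; last exact: K_ge1.
  by apply: mulr_ge0 => //; apply: exprn_ge0; lra.
have KL : K <= L.
  rewrite -LE mulrAC mulrC -[leLHS]mulr1; apply: ler_wpM2l; first exact: K_ge0.
  lra.
have CL : 5 * (5 * C * 5) <= L by lra.
have L1 : 1 <= L by lra.
have L4 : 1 <= L ^+ 4 by exact: exprn_ege1.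
have L24 : L ^+ 2 <= L ^+ 4 by exact: ler_weXn2l.
have L2 : L <= L ^+ 2 by rewrite -[leLHS]expr1; exact: ler_weXn2l.
(* As [r <= 1 / 4], this gives [372 * (L ^+ 4 * eps) <= 1], so the error [186 * (L ^+ 4 * eps ^+ 2)]
   of a step is at most [eps / 2]; all points, of norm at most [8 * e0], stay well inside the
   ball. *)
have [e0 e0_gt0 e0E] : exists2 e0, 0 < e0 & 400 * (L ^+ 4 * e0) = r.
  exists (r / 400 / L ^+ 4); last by field; apply/lt0r_neq0; lra.
  apply: divr_gt0; last lra.
  by have := r_gt0; lra.
have e0_ge0 := ltW e0_gt0.
have e0L2 : 400 * (L ^+ 2 * e0) <= r by have := ler_wpM2r e0_ge0 L24; lra.
have e0L : 400 * (L * e0) <= r by have := ler_wpM2r e0_ge0 L2; lra.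
have e0r : 400 * e0 <= r by have := ler_wpM2r e0_ge0 L1; lra.
have e0rho : 24 * e0 < rho.
  rewrite -rhoE ltr_pdivlMr; last lra.
  have := ler_wpM2r e0_ge0 D2L.
  by have := r_gt0; rewrite (_ : 24 * e0 * _ = 384 * (D ^+ 2 * e0)); [lra|ring].
clear D1 DD D2L L24 L2.
pose ep n := e0 * 2^-1 ^+ n.
have ep_gt0 n : 0 < ep n by rewrite mulr_gt0 // exprn_gt0.
have epS n : ep n.+1 = ep n / 2 by rewrite /ep exprS; field.
have ep_le n : ep n <= e0.
  by rewrite -[leRHS]mulr1 ler_wpM2l ?(ltW e0_gt0) // exprn_ile1 //; lra.
exists e0 => // H Hfin [H1 HM HV] HAd Hres.
(* The gain is quadratic, but halving is enough and makes the sums geometric: [4 * e0 - 4 * ep n] is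
   the sum of the first [n] displacements [2 * ep k]. *)
pose Inv n (x : E) := `|x| <= 4 * e0 - 4 * ep n /\
  forall h, H h -> exists g w, [/\ G g, `|w| <= ep n & ((ch x)^-1 * h * ch x)%g = (g * ch w)%g].
(* The constants do not deteriorate with the number of steps: the accumulated conjugator is one
   [ch x] with [x] small, and the bound is always derived from that of the original [h]. *)
have good x (h : U) g w : 20 * `|x| < r -> H h -> 10 * `|w| < r ->
    ((ch x)^-1 * h * ch x = g * ch w)%g -> exists A, conj_good L rho g^-1 A.
  move=> xr Hh wr xE; have x0 := normr_ge0 x; have w0 := normr_ge0 w.
  have nx := @nu_le x ltac:(lra).
  have -> : g^-1%g = (ch w * ((ch x)^-1 * h^-1 * ch x))%g.
    have -> : ((ch x)^-1 * h^-1 * ch x = (g * ch w)^-1)%g.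
      by rewrite -xE !invgM invgK mulgA.
    by rewrite invgM mulVKg.
  have Ad1 : Ad_le (5 * (5 * C * 5)) (ch w * ((ch x)^-1 * h^-1 * ch x))%g.
    apply: Ad_le_mul => //; first by apply: Ad_le_ball; lra.
    apply: Ad_le_mul; [lra| |by apply: Ad_le_ball; lra].
    apply: Ad_le_mul => //; last exact/HAd/HV.
    by rewrite chV; [apply: Ad_le_ball|]; lra.
  have C125 : 0 <= 5 * (5 * C * 5) by lra.
  have [A [Al AC Ag]] := conj_estimate C125 Ad1; exists A.
  rewrite DE rhoE LE in Ag; split => //.
  by move=> v; apply: le_trans (AC v) _; exact: ler_wpM2r.
have step n x : Inv n x -> exists2 x', Inv n.+1 x' & `|x' - x| <= 2 * ep n.
  move=> [xe xres].
  have en0 := ep_gt0 n; have ene := ep_le n; have x0 := normr_ge0 x.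
  pose H' := [set ((ch x)^-1 * h * ch x)%g | h in H].
  have xr : 20 * `|x| < r by lra.
  have cL2 : 128 * (L ^+ 2 * ep n) < r.
    have : L ^+ 2 * ep n <= L ^+ 2 * e0 by apply: ler_wpM2l => //; exact: sqr_ge0.
    by have := r_gt0; lra.
  have crho : 2 * ep n < rho by lra.
  have H'1 : H' 1%g by exists 1%g => //; rewrite mulg1 mulVg.
  have H'M u v : H' u -> H' v -> H' (u * v)%g.
    move=> [h Hh <-] [k Hk <-]; exists (h * k)%g; first exact: (HM).
    by rewrite !mulgA mulgK.
  have H'V u : H' u -> H' u^-1%g.
    move=> [h Hh <-]; exists h^-1%g; first exact: (HV).
    by rewrite !invgM invgK mulgA.
  have H'res u : H' u -> exists g w, [/\ G g, `|w| <= ep n & u = (g * ch w)%g].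
    by move=> [h Hh <-]; exact: xres.
  have H'good u g w : H' u -> `|w| <= ep n -> u = (g * ch w)%g ->
      exists A, conj_good L rho g^-1 A.
    by move=> [h Hh <-] we; apply: good => //; lra.
  have [y ye yres] := averaging_step KL en0 cL2 crho (finite_image _ Hfin) H'1 H'M H'V H'res H'good.
  have xr' : `|x| < r by lra.
  have y0 := normr_ge0 y; have yr : `|y| < r by lra.
  exists (mu x y).
    split; first by have := mu_le xr' yr; rewrite epS; lra.
    move=> h Hh; have [g [w [Gg we wE]]] := yres _ (ex_intro2 _ _ h Hh erefl).
    exists g, w; split => //.
    - apply: le_trans we _; rewrite epS.
      have Le : L ^+ 4 * ep n <= L ^+ 4 * e0.
        by apply: ler_wpM2l; [exact: le_trans L4|exact: ep_le].
      have Le1 : 372 * (L ^+ 4 * ep n) <= 1 by have := r_le; lra.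
      have := ler_wpM2r (ltW en0) Le1.
      by rewrite (_ : 186 * (L ^+ 4 * ep n ^+ 2) = 372 * (L ^+ 4 * ep n) * ep n / 2); [lra|field].
    - by rewrite -wE -chM // invgM !mulgA.
  have := mu_lip_r xr' norm0_lt yr; rewrite mux0 // subr0; lra.
have [f fS] : exists f : nat -> E, forall n, Inv n (f n) /\ `|f n.+1 - f n| <= 2 * ep n.
  have /choice[F FP] : forall p : nat * E, exists x',
      Inv p.1 p.2 -> Inv p.1.+1 x' /\ `|x' - p.2| <= 2 * ep p.1.
    move=> [n x] /=; have [/step[x' ? ?]|nI] := pselect (Inv n x); first by exists x'.
    by exists 0.
  pose f := nat_rect (fun=> E) 0 (fun n x => F (n, x)).
  have f_Inv n : Inv n (f n).
    elim: n => [|n /(FP (n, _))[]//]; split.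
      by rewrite normr0 /ep expr0 mulr1 subrr.
    move=> h /Hres[g [w [Gg we wE]]]; exists g, w; split => //.
      by rewrite /ep expr0 mulr1.
    by rewrite /= ch0 invg1 mul1g mulg1.
  by exists f => n; split=> //; have [] := FP (n, f n) (f_Inv n).
have [x xf] := @geometric_cvg f e0 (ltW e0_gt0) (fun n => proj2 (fS n)).
exists (ch x) => h Hh; apply: approx_in_G => d d0.
have f_le n : `|f n| <= 4 * e0.
  by have [[? _] _] := fS n; have := ep_gt0 n; lra.
have x_le : `|x| <= 8 * e0.
  have := xf 0; rewrite expr0 mulr1 => x0.
  by have := ler_normD (x - f 0) (f 0); rewrite subrK; have := f_le 0; lra.
have L0 : 0 < L by lra.
(* [e0 / 8] makes [8 * ep n] small enough for [conj_residual], and [88 = 11 * 8] comes from its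
   bound on [t]. *)
have [n] := @ex_half_lt e0 (Num.min (e0 / 8) (d / (88 * L)))
  ltac:(by rewrite lt_min !divr_gt0 // mulr_gt0).
rewrite -/(ep n) lt_min ltr_pdivlMr // ltr_pdivlMr ?mulr_gt0 // => /andP[n8 nd].
have [[_ fres] _] := fS n; have [g [w [Gg we wE]]] := fres h Hh.
have en0 := ep_gt0 n; have fn := f_le n; have fn0 := normr_ge0 (f n).
have fr : `|f n| < r by lra.
have xr : `|x| < r by have := normr_ge0 x; lra.
have nf := nu_le fr; have nfr : `|nu (f n)| < r by lra.
(* Conjugating by the limit is conjugating by [ch (f n)] and then by the small [ch y], so the
   residual in the limit is still of order [ep n]. *)
pose y := mu (nu (f n)) x.
have ye : `|y| <= 8 * ep n.
  have := mu_lip_r nfr fr xr; rewrite mu_nul; last by lra.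
  by rewrite subr0 -/y; have := xf n; rewrite -/(ep n); lra.
have chx : ch x = (ch (f n) * ch y)%g by rewrite /y -chM // -chV // mulVKg.
have [A Ag] := good (f n) h g w ltac:(lra) Hh ltac:(lra) wE.
have e8 : 0 < 8 * ep n by lra.
have cL2 : 128 * (L ^+ 2 * (8 * ep n)) < r.
  have : L ^+ 2 * (8 * ep n) <= L ^+ 2 * e0.
    by apply: ler_wpM2l; [exact: sqr_ge0|lra].
  by have := r_gt0; lra.
have crho : 2 * (8 * ep n) < rho by lra.
have [t tE [_ te]] := conj_residual KL e8 cL2 crho Ag (w := w) (y := y) ltac:(lra) ye.
exists g, t; split => //.
  by apply: le_trans te _; lra.
by rewrite -tE -wE chx invgM !mulgA.
Qed.

End LocalGroup.

(** * From a split submanifold to a local group chart *)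

Lemma lin_map_bounded (R : realType) (V W : normedModType R) (p : V -> W) :
  lin_map p -> {for 0, continuous p} -> exists2 B, 0 <= B & forall v, `|p v| <= B * `|v|.
Proof.
move=> pl /cvgrPdist_lt /(_ 1 ltr01) /near_normP[d d0 Hd].
exists (2 / d) => [|v]; first by rewrite divr_ge0 // ltW.
have [->|v0] := eqVneq v 0; first by rewrite (lin_map0 pl) !normr0 mulr0.
have vn : 0 < `|v| by rewrite normr_gt0.
have := Hd ((d / 2 / `|v|) *: v); rewrite subr0 normrZ gtr0_norm ?divr_gt0 //.
rewrite divfK ?lt0r_neq0 // => /(_ ltac:(lra)).
rewrite (lin_map0 pl) sub0r normrN (lin_mapZ pl) normrZ gtr0_norm ?divr_gt0 // => H.
rewrite [leRHS](_ : _ = (d / 2 / `|v|)^-1); last by field; rewrite !lt0r_neq0.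
by rewrite -[leRHS]mulr1 ler_pdivlMl ?divr_gt0 // ltW.
Qed.

(** The definition gives [p] only as a continuous map; uniqueness of the decomposition along [F] and
    [F'] makes [q v = v - p v] linear and idempotent, and continuity at 0 then bounds it. *)
Lemma split_projection (R : realType) (E : normedModType R) (F F' : set E) :
  topological_complement F F' -> exists q : E -> E,
    [/\ lin_map q, exists2 B, 0 <= B & forall v, `|q v| <= B * `|v|,
        forall v, q (q v) = q v & forall v, F v <-> q v = 0].
Proof.
move=> [[[F0 Fl] _] [[F'0 F'l] _] FF' [p pc pP]].
have sub0 v : F v -> F' v -> v = 0.
  by move=> Fv F'v; have : (F `&` F') v by []; rewrite FF'.
have FB u v : F u -> F v -> F (u - v).
  by move=> Fu Fv; rewrite addrC -scaleN1r; exact: Fl.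
have F'B u v : F' u -> F' v -> F' (u - v).
  by move=> Fu Fv; rewrite addrC -scaleN1r; exact: F'l.
pose q v := v - p v.
have qF' v : F' (q v) by have [] := pP v.
have qlin : lin_map q.
  move=> a u v; apply/eqP; rewrite -subr_eq0; apply/eqP; apply: sub0.
    rewrite (_ : _ - _ = (a *: p u + p v) - p (a *: u + v)).
      by apply: FB; [apply: Fl|]; have [] := pP (a *: u + v); have [] := pP u; have [] := pP v.
    have aq : a *: (u - p u) = a *: u - a *: p u by rewrite scalerBr.
    by rewrite /q aq; zmod.
  by apply: F'B => //; exact: F'l.
have Fq v : F v <-> q v = 0.
  split=> [Fv|/eqP]; last by rewrite subr_eq0 => /eqP ->; have [] := pP v.
  by apply: sub0 => //; apply: FB => //; have [] := pP v.
exists q; split => //.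
- apply: lin_map_bounded => //.
  by move=> ?; apply: cvgB; [exact: cvg_id|exact: pc].
- move=> v; apply/eqP; rewrite -subr_eq0; apply/eqP; apply: sub0; last exact: F'B.
  rewrite (_ : _ - _ = - p (q v)); last by rewrite {1}/q; zmod.
  rewrite -sub0r; apply: FB => //; by have [] := pP (q v).
Qed.

Section AdaptedChart.
Variables (R : realType) (U : banachLieGroup R) (G : set U).
Local Notation E := (lie_model U).
Variables (c c0 : chart U E).
Hypothesis c_dom1 : chart_dom c 1%g.
Hypothesis c0_dom1 : chart_dom c0 1%g.
Hypothesis c0_atlas : atlas_charts (lie_atlas U) c0.
Hypothesis c_compat : forall d, atlas_charts (lie_atlas U) d -> chart_compatible c d.

(** The chart translated so that 1 has coordinate 0; it stands in for the exponential map. *)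
Definition chart_exp (v : E) : U := chart_inv c (v + c 1%g).
Definition chart_log (x : U) : E := c x - c 1%g.
Definition chart_mul (x y : E) : E := chart_log (chart_exp x * chart_exp y)%g.
Definition chart_opp (x : E) : E := chart_log (chart_exp x)^-1%g.

Lemma chart_exp0 : chart_exp 0 = 1%g.
Proof. by rewrite /chart_exp add0r chart_mapK. Qed.

Lemma chart_expK x : chart_dom c x -> chart_exp (chart_log x) = x.
Proof. by move=> cx; rewrite /chart_exp /chart_log subrK chart_mapK. Qed.

Lemma chart_img_near : \forall v \near (0 : E), (c @` chart_dom c) (v + c 1%g).
Proof.
have : nbhs (c 1%g) (c @` chart_dom c).
  by apply: open_nbhs_nbhs; split; [exact: chart_img_open|exists 1%g].
move=> /near_normP[r r0 H]; apply/near_normP; exists r => // v.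
by rewrite subr0 => vr; apply: H; rewrite addrK.
Qed.

Lemma chart_logK v : (c @` chart_dom c) (v + c 1%g) -> chart_log (chart_exp v) = v.
Proof.
by move=> [x cx xv]; rewrite /chart_log /chart_exp -xv chart_mapK // xv addrK.
Qed.

Lemma chart_exp_cvg : chart_exp v @[v --> (0 : E)] --> (1%g : U).
Proof.
rewrite -[X in _ --> X]chart_exp0.
apply: (@continuous_comp _ _ _ (fun v : E => v + c 1%g) (chart_inv c)).
  exact: C11_continuous (C11_shift _ _).
by apply: chart_inv_continuous; rewrite add0r; exists 1%g.
Qed.

Lemma chart_dom_nbhs (d : chart U E) x : chart_dom d x -> nbhs x (chart_dom d).
Proof. by move=> dx; apply: open_nbhs_nbhs; split => //; exact: chart_dom_open. Qed.

Lemma chart_exp_nbhs (e : R) : 0 < e -> nbhs (1%g : U) (chart_exp @` [set v | `|v| <= e]).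
Proof.
move=> e0; have : nbhs (c 1%g) [set w | `|w - c 1%g| < e].
  by apply/near_normP; exists e.
move=> /(chart_map_continuous c_dom1) H.
apply: filterS2 (chart_dom_nbhs c_dom1) H => x cx /= xe.
by exists (chart_log x); [exact: ltW|exact: chart_expK].
Qed.

Lemma chart_expM_cvg :
  (chart_exp z.1 * chart_exp z.2)%g @[z --> (0 : E * E)] --> (1%g : U).
Proof.
have H : (chart_exp z.1, chart_exp z.2) @[z --> (0 : E * E)] --> ((1%g, 1%g) : U * U).
  apply: cvg_pair => /=.
    by apply: (cvg_comp _ _ cvg_fst); exact: chart_exp_cvg.
  by apply: (cvg_comp _ _ cvg_snd); exact: chart_exp_cvg.
by have := cvg_comp _ _ H (@mulg_continuous U (1%g, 1%g)); rewrite /= mulg1.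
Qed.

Lemma chart_expV_cvg : (chart_exp v)^-1%g @[v --> (0 : E)] --> (1%g : U).
Proof.
rewrite -[X in _ --> X]invg1; apply: (cvg_comp _ _ chart_exp_cvg).
exact: invg_continuous.
Qed.

Lemma chart_log_cvg : chart_log x @[x --> (1%g : U)] --> (0 : E).
Proof.
rewrite -(subrr (c 1%g)); apply: cvgB; last exact: cvg_cst.
exact: chart_map_continuous.
Qed.

(** The adapted chart [c] is compatible with the atlas but need not belong to it, whereas
    [lie_mul_analytic] speaks of charts of the atlas. The product is therefore computed in [c0],
    with the transition maps on both sides. *)
Lemma chart_mul_C11 : C11_at (fun z : E * E => chart_mul z.1 z.2) 0.
Proof.
have [a1 a2] := c_compat c0_atlas c_dom1 c0_dom1.
pose tau v := c0 (chart_exp v).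
have tau_C11 : C11_at tau 0.
  apply: (@C11_comp _ _ _ _ (fun v => v + c 1%g) (c0 \o chart_inv c)).
    exact: C11_shift.
  by rewrite add0r; exact: analytic_C11.
have tau0 : tau 0 = c0 1%g by rewrite /tau chart_exp0.
pose m (z : E * E) := c0 (chart_inv c0 z.1 * chart_inv c0 z.2)%g.
have m_C11 : C11_at m (c0 1%g, c0 1%g).
  by apply/analytic_C11/lie_mul_analytic; rewrite ?mulg1.
pose f (z : E * E) := (c \o chart_inv c0) (m (tau z.1, tau z.2)) + (- c 1%g).
apply: (@C11_near _ _ _ f).
  have d1 : \forall z \near (0 : E * E), chart_dom c0 (chart_exp z.1).
    have /(cvg_comp _ _ cvg_fst) : chart_exp v @[v --> (0 : E * E).1] --> (1%g : U).
      exact: chart_exp_cvg.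
    by apply; exact: chart_dom_nbhs.
  have d2 : \forall z \near (0 : E * E), chart_dom c0 (chart_exp z.2).
    have /(cvg_comp _ _ cvg_snd) : chart_exp v @[v --> (0 : E * E).2] --> (1%g : U).
      exact: chart_exp_cvg.
    by apply; exact: chart_dom_nbhs.
  have d3 : \forall z \near (0 : E * E), chart_dom c0 (chart_exp z.1 * chart_exp z.2)%g.
    exact: (chart_expM_cvg (chart_dom_nbhs c0_dom1)).
  apply: filterS3 d1 d2 d3 => z z1 z2 z12.
  by rewrite /f /= /m /tau /= !chart_mapK.
apply: (@C11_comp _ _ _ _ (fun z => (c \o chart_inv c0) (m (tau z.1, tau z.2)))
  (fun v => v + - c 1%g)); last exact: C11_shift.
apply: (@C11_comp _ _ _ _ (fun z : E * E => m (tau z.1, tau z.2)) (c \o chart_inv c0)); last first.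
  by rewrite /m /= tau0 chart_mapK // mulg1; exact: analytic_C11.
apply: (@C11_comp _ _ _ _ (fun z : E * E => (tau z.1, tau z.2)) m); last first.
  by rewrite /= tau0.
apply: C11_pair.
  by apply: (@C11_comp _ _ _ _ (fun z : E * E => z.1) tau); [exact: C11_fst|exact: tau_C11].
by apply: (@C11_comp _ _ _ _ (fun z : E * E => z.2) tau); [exact: C11_snd|exact: tau_C11].
Qed.

Lemma adapted_local_group_chart (F : set E) : subgroup G -> split_subspace F ->
  c @` (chart_dom c `&` G) = (c @` chart_dom c) `&` F ->
  exists q r K, local_group_chart G chart_exp chart_mul chart_opp q r K.
Proof.
move=> Ggrp [F' FF'] GF.
have [q [qlin [B B0 qB] qK Fq]] := split_projection FF'.
(* As 1 lies in [G], its coordinate lies in [F], and translating the chart by it preserves the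
   slice. *)
have Fc1 : F (c 1%g).
  suff : (c @` (chart_dom c `&` G)) (c 1%g) by rewrite GF => -[].
  by exists 1%g => //; split => //; case: Ggrp.
have [[F0 Fl] _] : linear_subspace F /\ closed F by case: FF'.
have [K [r [K0 r0 m1 m2]]] := chart_mul_C11.
have /near_normP[r1 r10 H1] := chart_img_near.
have /near_normP[r2 r20 H2] := chart_expM_cvg (chart_dom_nbhs c_dom1).
have /near_normP[r3 r30 H3] := chart_expV_cvg (chart_dom_nbhs c_dom1).
pose K' := K + B + 1.
have K'1 : 1 <= K' by rewrite /K'; lra.
pose R1 := Num.min (Num.min r (4 * K')^-1) (Num.min r1 r2).
have R10 : 0 < R1.
  by rewrite !lt_min r0 r10 r20 invr_gt0 mulr_gt0 //; lra.
have oppc : chart_opp v @[v --> (0 : E)] --> (0 : E).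
  exact: (cvg_comp _ _ chart_expV_cvg chart_log_cvg).
have /cvgrPdist_lt /(_ R1 R10) /near_normP[r4 r40 H4] := oppc.
(* Two radii are used: a point of norm below [R2] has an inverse of norm below [R1], so the
   estimates on the product apply to both. *)
pose R2 := Num.min R1 (Num.min r3 r4).
have R2_lt (x : E) : `|x| < R2 -> [/\ `|x| < R1, `|x| < r3 & `|x| < r4].
  by rewrite !lt_min => /and3P[].
have R1_lt (x : E) : `|x| < R1 -> [/\ `|x| < r, `|x| < (4 * K')^-1, `|x| < r1 & `|x| < r2].
  by rewrite !lt_min => /andP[/andP[-> ->] /andP[-> ->]].
have logK x : `|x| < R1 -> chart_log (chart_exp x) = x.
  by move=> /R1_lt[_ _ xr _]; apply: chart_logK; apply: H1; rewrite subr0.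
have mu_near x y : `|x| < R1 -> `|y| < R1 ->
    (chart_exp x * chart_exp y)%g = chart_exp (chart_mul x y).
  move=> /R1_lt[_ _ _ xr] /R1_lt[_ _ _ yr]; rewrite chart_expK //.
  by apply: (H2 (x, y)); rewrite subr0 prod_normE /= gt_max xr yr.
have x0 x : `|x| < R1 -> chart_mul x 0 = x.
  by move=> xr; rewrite /chart_mul chart_exp0 mulg1 logK.
have _0x x : `|x| < R1 -> chart_mul 0 x = x.
  by move=> xr; rewrite /chart_mul chart_exp0 mul1g logK.
have n0 : `|0 : E| < R1 by rewrite normr0.
have KK' : K <= K' by rewrite /K'; lra.
have mur x y z : `|x| < R1 -> `|y| < R1 -> `|z| < R1 ->
    `|chart_mul x z - chart_mul x y - (z - y)| <= K' * (`|x| * `|z - y|).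
  move=> xr yr zr; have [xr' _ _ _] := R1_lt _ xr; have [yr' _ _ _] := R1_lt _ yr.
  have [zr' _ _ _] := R1_lt _ zr.
  (* Since 0 is neutral for [chart_mul], the quantity to bound is the second difference of the
     product at [(0, y)] in the directions [(x, 0)] and [(0, z - y)]. *)
  have := m2 (0, y) (x, 0) (0, z - y).
  have -> : (0, y) + (x, 0) + (0, z - y) = (x, z) :> E * E.
    by congr (_, _) => /=; zmod.
  have -> : (0, y) + (x, 0) = (x, y) :> E * E by congr (_, _) => /=; zmod.
  have -> : (0, y) + (0, z - y) = (0, z) :> E * E by congr (_, _) => /=; zmod.
  rewrite !subr0 !prod_normE /= !normr0 !gt_max !r0 xr' yr' zr' /= !_0x //.
  move=> /(_ isT isT isT isT).
  rewrite (max_l (normr_ge0 x)) (max_r (normr_ge0 (z - y))).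
  rewrite (_ : chart_mul x z - chart_mul x y - (z - y) = chart_mul x z - chart_mul x y - z + y);
    last by zmod.
  by move=> /le_trans; apply; rewrite ler_wpM2r // mulr_ge0.
have mul_ x y z : `|x| < R1 -> `|y| < R1 -> `|z| < R1 ->
    `|chart_mul z x - chart_mul y x - (z - y)| <= K' * (`|x| * `|z - y|).
  move=> xr yr zr; have [xr' _ _ _] := R1_lt _ xr; have [yr' _ _ _] := R1_lt _ yr.
  have [zr' _ _ _] := R1_lt _ zr.
  have := m2 (y, 0) (0, x) (z - y, 0).
  have -> : (y, 0) + (0, x) + (z - y, 0) = (z, x) :> E * E.
    by congr (_, _) => /=; zmod.
  have -> : (y, 0) + (0, x) = (y, x) :> E * E by congr (_, _) => /=; zmod.
  have -> : (y, 0) + (z - y, 0) = (z, 0) :> E * E by congr (_, _) => /=; zmod.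
  rewrite !subr0 !prod_normE /= !normr0 !gt_max !r0 xr' yr' zr' /= !x0 //.
  move=> /(_ isT isT isT isT).
  rewrite (max_r (normr_ge0 x)) (max_l (normr_ge0 (z - y))).
  rewrite (_ : chart_mul z x - chart_mul y x - (z - y) = chart_mul z x - chart_mul y x - z + y);
    last by zmod.
  by move=> /le_trans; apply; rewrite ler_wpM2r // mulr_ge0.
have R2R1 (x : E) : `|x| < R2 -> `|x| < R1 by move=> /R2_lt[].
have K'R1 : 4 * (K' * R1) <= 1.
  have : R1 <= (4 * K')^-1 by rewrite /R1 !ge_min lexx orbT.
  by rewrite -[leRHS]mul1r ler_pdivlMr ?mulr_gt0 //; lra.
have R2le : R2 <= R1 by rewrite ge_min lexx.
have oppE x : `|x| < R2 -> (chart_exp x)^-1%g = chart_exp (chart_opp x).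
  move=> /R2_lt[_ xr _]; rewrite chart_expK //.
  by apply: (H3 x); rewrite subr0.
have opp_lt x : `|x| < R2 -> `|chart_opp x| < R1.
  by move=> /R2_lt[_ _ xr]; have := H4 x; rewrite subr0 sub0r normrN; exact.
exists q, R2, K'; split => //.
- by rewrite /R2 lt_min R10 lt_min r30 r40.
- have := @ler_wpM2l _ K' _ _ _ R2le; lra.
- exact: chart_exp0.
- by move=> x y /R2R1/logK xE /R2R1/logK yE xy; rewrite -xE -yE xy.
- by move=> x y /R2R1 xr /R2R1 yr; exact: mu_near.
(* The bound on the inverse comes from the product: [x] times its inverse has coordinate 0, so
   [|x + chart_opp x|] is at most a quarter of [|chart_opp x|]. *)
- move=> x xr; have nr := opp_lt x xr; have := mur x 0 (chart_opp x) (R2R1 _ xr) n0 nr.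
  have -> : chart_mul x (chart_opp x) = 0.
    by rewrite /chart_mul -oppE // mulgV /chart_log subrr.
  rewrite x0 ?subr0; last exact: R2R1.
  have -> : 0 - x - chart_opp x = - (x + chart_opp x) by zmod.
  rewrite normrN => H; have := ler_normB (x + chart_opp x) x.
  rewrite (_ : x + chart_opp x - x = chart_opp x); last by zmod.
  have : K' * `|x| * `|chart_opp x| <= 4^-1 * `|chart_opp x|.
    apply: ler_wpM2r => //.
    have := @ler_wpM2l _ K' ltac:(lra) _ _ (ltW (R2R1 _ xr)); lra.
  rewrite -mulrA; have := normr_ge0 (chart_opp x); lra.
- by move=> x /R2R1; exact: x0.
- by move=> x y z /R2R1 ? /R2R1 ? /R2R1 ?; exact: mur.
- by move=> x y z /R2R1 ? /R2R1 ? /R2R1 ?; exact: mul_.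
- by move=> v; apply: le_trans (qB v) _; rewrite ler_wpM2r // /K'; lra.
- move=> v vr; have img : (c @` chart_dom c) (v + c 1%g).
    by apply: H1; rewrite subr0; have [] := R1_lt _ (R2R1 _ vr).
  rewrite -Fq; split=> [Gv|Fv].
    have : (c @` (chart_dom c `&` G)) (v + c 1%g).
      case: img => x cx xv; exists x => //; split => //.
      by move: Gv; rewrite /chart_exp -xv chart_mapK.
    rewrite GF => -[_ Fv]; rewrite (_ : v = -1 *: c 1%g + (v + c 1%g)); first exact: Fl.
    by rewrite scaleN1r; zmod.
  have : (c @` (chart_dom c `&` G)) (v + c 1%g).
    by rewrite GF; split => //; have := Fl 1 _ _ Fv Fc1; rewrite scale1r.
  by move=> [x [cx Gx] xv]; rewrite /chart_exp -xv chart_mapK.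
Qed.

End AdaptedChart.

(** * The adjoint action in different charts *)

Section AdjointChart.
Variables (R : realType) (U : banachLieGroup R).
Local Notation E := (lie_model U).

Lemma conj_cvg (g : U) : (g * x * g^-1)%g @[x --> (1%g : U)] --> (1%g : U).
Proof.
have H1 : ((g, x) : U * U) @[x --> (1%g : U)] --> ((g, 1%g) : U * U).
  by apply: cvg_pair => /=; [exact: cvg_cst|exact: cvg_id].
have /= H2 := cvg_comp _ _ H1 (@mulg_continuous U (g, 1%g)).
have H3 : (((g * x)%g, g^-1%g) : U * U) @[x --> (1%g : U)] --> (((g * 1)%g, g^-1%g) : U * U).
  by apply: cvg_pair => /=; [exact: H2|exact: cvg_cst].
have /= := cvg_comp _ _ H3 (@mulg_continuous U ((g * 1)%g, g^-1%g)).
by rewrite mulg1 mulgV.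
Qed.

Lemma chart_inv_cvg (c : chart U E) : chart_dom c 1%g ->
  chart_inv c v @[v --> c 1%g] --> (1%g : U).
Proof.
move=> c1; have H : chart_inv c v @[v --> c 1%g] --> chart_inv c (c 1%g).
  by apply: chart_inv_continuous; exists 1%g.
by rewrite chart_mapK in H.
Qed.

(** Conjugation is a left translation from 1 to [g] followed by a right translation back to 1. The
    chart [d] around [g] links the two, and each is a partial map of the analytic product. *)
Lemma conj_fderiv (c : chart U E) (g : U) : atlas_charts (lie_atlas U) c ->
  chart_dom c 1%g ->
  exists L, fderiv (fun v => c (g * chart_inv c v * g^-1)%g) (c 1%g) L.
Proof.
move=> cA c1; have [d dA dg] := atlas_cover (lie_atlas U) g.
have [e eA eg] := atlas_cover (lie_atlas U) g^-1%g.
have [L1 fL1] : exists L, fderiv (fun v => d (g * chart_inv c v)%g) (c 1%g) L.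
  have /analytic_fderiv[L fL] := lie_mul_analytic dA cA dA dg c1 ltac:(by rewrite mulg1).
  exists (L \o (fun v => (0, v))).
  have := fderiv_comp (fderiv_pair_cst (d g) (c 1%g)) fL.
  by apply: fderiv_near; apply: nearW => v /=; rewrite chart_mapK.
have [L2 fL2] : exists L, fderiv (fun w => c (chart_inv d w * g^-1)%g) (d g) L.
  have /analytic_fderiv[L fL] := lie_mul_analytic dA eA cA dg eg ltac:(by rewrite mulgV).
  exists (L \o (fun v => (v, 0))).
  have := fderiv_comp (fderiv_cst_pair (e g^-1%g) (d g)) fL.
  by apply: fderiv_near; apply: nearW => v /=; rewrite chart_mapK.
exists (L2 \o L1).
have fL2' : fderiv (fun w => c (chart_inv d w * g^-1)%g) (d (g * chart_inv c (c 1%g))%g) L2.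
  by rewrite chart_mapK // mulg1.
apply: fderiv_near (fderiv_comp fL1 fL2').
have H : (g * chart_inv c v)%g @[v --> c 1%g] --> g.
  have H1 : ((g, chart_inv c v) : U * U) @[v --> c 1%g] --> ((g, 1%g) : U * U).
    by apply: cvg_pair => /=; [exact: cvg_cst|exact: chart_inv_cvg].
  by have /= := cvg_comp _ _ H1 (@mulg_continuous U (g, 1%g)); rewrite mulg1.
have nd : \forall v \near c 1%g, chart_dom d (g * chart_inv c v)%g.
  exact: (H _ (chart_dom_nbhs dg)).
apply: filterS nd => v dv /=.
by rewrite chart_mapK.
Qed.

Variables (c c0 : chart U E).
Hypothesis c_dom1 : chart_dom c 1%g.
Hypothesis c_compat : forall d, atlas_charts (lie_atlas U) d -> chart_compatible c d.
Hypothesis c0_atlas : atlas_charts (lie_atlas U) c0.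
Hypothesis c0_dom1 : chart_dom c0 1%g.

(** [B] is the product of the norms of the derivatives of the two transition maps at 1, so a bound
    for Ad in a chart of the atlas carries over to the adapted chart with a factor independent of
    [g]. *)
Lemma Ad_le_chart_exp : exists2 B, 0 <= B & forall g C, 0 <= C ->
  (forall v, `|Ad c0 g v| <= C * `|v|) -> Ad_le (chart_exp c) (B * C) g.
Proof.
have [a1 a2] := c_compat c0_atlas c_dom1 c0_dom1.
have [T fT] := analytic_fderiv a1; have [S fS] := analytic_fderiv a2.
have [_ [BT BT0 TB] _] := fT; have [_ [BS BS0 SB] _] := fS.
exists (BS * BT) => [|g C C0 AdC]; first exact: mulr_ge0.
have [L fL] := conj_fderiv g c0_atlas c0_dom1.
have AdE : Ad c0 g = L by exact: fderiv_diff fL.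
rewrite AdE in AdC.
have f1 : fderiv ((c0 \o chart_inv c) \o (fun v => v + c 1%g)) 0 (T \o id).
  by apply: fderiv_comp (fderiv_shift _ _) _; rewrite add0r.
have f2 := @fderiv_comp _ _ _ _ _ (fun v => c0 (g * chart_inv c0 v * g^-1)%g) _ _ L f1
  ltac:(by rewrite /= add0r chart_mapK).
have f3 := @fderiv_comp _ _ _ _ _ (c \o chart_inv c0) _ _ S f2
  ltac:(by rewrite /= add0r !chart_mapK // mulg1 mulgV).
have f4 := fderiv_comp f3 (fderiv_shift (- c 1%g) _).
set f := (X in fderiv X) in f4; set A := (X in fderiv _ _ X) in f4.
have f0 : f 0 = 0.
  rewrite /f /= add0r (chart_mapK c_dom1) (chart_mapK c0_dom1) mulg1 mulgV.
  by rewrite (chart_mapK c0_dom1) subrr.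
have [Al _ Ad] := f4.
exists A; split => //.
  move=> v; rewrite /A /=; apply: le_trans (SB _) _.
  rewrite -2!mulrA; apply: ler_wpM2l => //; apply: le_trans (AdC _) _.
  by rewrite mulrCA; apply: ler_wpM2l.
have n1 : \forall v \near (0 : E), chart_dom c0 (chart_exp c v).
  exact: (chart_exp_cvg c_dom1 (chart_dom_nbhs c0_dom1)).
have cj := cvg_comp _ _ (chart_exp_cvg c_dom1) (@conj_cvg g).
have n2 : \forall v \near (0 : E), chart_dom c0 (g * chart_exp c v * g^-1)%g.
  exact: (cj _ (chart_dom_nbhs c0_dom1)).
have n3 : \forall v \near (0 : E), chart_dom c (g * chart_exp c v * g^-1)%g.
  exact: (cj _ (chart_dom_nbhs c_dom1)).
have : \forall v \near (0 : E), (g * chart_exp c v * g^-1)%g = chart_exp c (f v).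
  apply: filterS3 n1 n2 n3 => v d1 d2 d3.
  by rewrite /f /= (chart_mapK d1) (chart_mapK d2) [RHS](chart_expK d3).
move=> /near_normP[r r0 Hr] eta eta0; have [d d0 Hd] := Ad eta eta0.
exists (Num.min d r) => [|v]; first by rewrite lt_min d0 r0.
rewrite lt_min => /andP[vd vr]; exists (f v); first by apply: Hr; rewrite subr0.
by have := Hd v vd; rewrite add0r f0 subr0.
Qed.

Lemma Ad_le_exists g : exists C, Ad_le (chart_exp c) C g.
Proof.
have [B B0 H] := Ad_le_chart_exp; have [L fL] := conj_fderiv g c0_atlas c0_dom1.
have [_ [C C0 LC] _] := fL; exists (B * C); apply: H => // v.
by rewrite /Ad (fderiv_diff fL).
Qed.

End AdjointChart.

(** * Jordan constants under conjugation *)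

Section JordanConstant.
Variables (R : realType) (U : groupType).
Implicit Types (H A X Y : set U) (x : U).

Lemma group_index_conj x H A : finite_set H ->
  group_index [set (x^-1 * h * x)%g | h in H] [set (x^-1 * a * x)%g | a in A] =
  group_index H A.
Proof.
move=> Hfin; pose f y := (x^-1 * y * x)%g.
have finj : injective f by move=> y z /mulIg /mulgI.
have fM y z : f (y * z)%g = (f y * f z)%g by rewrite /f !mulgA mulgK.
have cosetE h : [set (f h * a)%g | a in f @` A] = f @` [set (h * a)%g | a in A].
  apply/seteqP; split=> [_ [_ [a Aa <-] <-]|_ [_ [a Aa <-] <-]].
    by exists (h * a)%g; [exists a|exact: fM].
  by exists (f a); [exists a|rewrite fM].
have imE : left_cosets (f @` H) (f @` A) = [set f @` S | S in left_cosets H A].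
  apply/seteqP; split=> [_ [_ [h Hh <-] <-]|_ [_ [h Hh <-] <-]].
    by exists [set (h * a)%g | a in A]; [exists h|rewrite cosetE].
  by exists (f h); [exists h|exact: cosetE].
rewrite /group_index imE fset_set_image; last exact: finite_image.
rewrite card_imfset // => S T ST.
have sub S1 S2 : f @` S1 = f @` S2 -> S1 `<=` S2.
  move=> S12 y S1y; have : (f @` S2) (f y) by rewrite -S12; exists y.
  by move=> [z S2z /finj <-].
by apply/seteqP; split; exact: sub.
Qed.

Lemma min_abelian_index_conj_le x H X : finite_set H -> subgroup H ->
  (forall h, H h -> X (x^-1 * h * x)%g) ->
  (min_abelian_index R H <= jordan_constant R X)%E.
Proof.
move=> Hfin [H1 HM HV] HX.
pose H' := [set (x^-1 * h * x)%g | h in H].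
have fM y z : (x^-1 * (y * z) * x = (x^-1 * y * x) * (x^-1 * z * x))%g.
  by rewrite !mulgA mulgK.
have fV y : (x^-1 * y^-1 * x = (x^-1 * y * x)^-1)%g by rewrite !invgM invgK mulgA.
have H'grp : subgroup H'.
  split; first by exists 1%g => //; rewrite mulg1 mulVg.
  - by move=> _ _ [h Hh <-] [k Hk <-]; exists (h * k)%g; [exact: (HM)|exact: fM].
  - by move=> _ [h Hh <-]; exists h^-1%g; [exact: (HV)|exact: fV].
apply: (@le_trans _ _ (min_abelian_index R H')); last first.
  apply: ereal_sup_ubound; right; exists H' => //; split => //.
    exact: finite_image.
  by move=> _ [h Hh <-]; exact: HX.
(* Each abelian normal subgroup of the conjugate is pulled back to one of [H] with the same
   index. *)
apply: le_ereal_inf_tmp => _ [A' [[A'1 A'M A'V] A'H A'n A'c] <-].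
pose A := [set a | A' (x^-1 * a * x)%g].
have AE : [set (x^-1 * a * x)%g | a in A] = A'.
  apply/seteqP; split=> [_ [a Aa <-]//|a A'a].
  by exists (x * a * x^-1)%g; rewrite /A /= ?mulgA ?mulVg ?mul1g ?mulgVK.
rewrite -AE group_index_conj //; apply: ereal_inf_lbound; exists A => //.
split; first split.
- by rewrite /A /= mulg1 mulVg.
- by move=> a b; rewrite /A /= fM; exact: A'M.
- by move=> a; rewrite /A /= fV; exact: A'V.
- move=> a /A'H[h Hh /mulIg/mulgI <-] //.
- by move=> h a Hh Aa; rewrite /A /= 2!fM fV; apply: A'n => //; exists h.
- move=> a b Aa Ab; have := A'c _ _ Aa Ab.
  by rewrite -!fM => /mulIg/mulgI.
Qed.

Lemma jordan_constant_le X Y : (forall H, subgroup H -> finite_set H -> H `<=` X ->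
    exists x, forall h, H h -> Y (x^-1 * h * x)%g) ->
  (jordan_constant R X <= jordan_constant R Y)%E.
Proof.
move=> XY; apply: ge_ereal_sup => _ [->|[H [Hg Hf HX] <-]].
  by apply: ereal_sup_ubound; left.
by have [x xP] := XY H Hg Hf HX; exact: (min_abelian_index_conj_le (x := x)).
Qed.

Lemma jordan_constant_mono X Y : X `<=` Y ->
  (jordan_constant R X <= jordan_constant R Y)%E.
Proof.
move=> XY; apply: jordan_constant_le => H _ _ HX; exists 1%g => h /HX/XY.
by rewrite invg1 mul1g mulg1.
Qed.

End JordanConstant.

(** * The neighborhoods in both statements *)

Lemma Ad_le_jordan (R : realType) (U : banachLieGroup R) (G : set U)
    (c : chart U (lie_model U)) mu nu q r K (C : R) (S : set U) :
  chart_dom c 1%g -> local_group_chart G (chart_exp c) mu nu q r K ->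
  (forall g, exists C, Ad_le (chart_exp c) C g) ->
  (forall g, S g -> Ad_le (chart_exp c) C g) ->
  exists2 V : set U, nbhs (1%g : U) V
    & (jordan_constant R (set_mulg G V `&` S) <= jordan_constant R G)%E.
Proof.
move=> c1 lc Ad_all SC.
have [eps eps0 epsP] := conj_into_G lc Ad_all (C := Num.max 1 C) ltac:(by rewrite le_max lexx).
exists (chart_exp c @` [set v | `|v| <= eps]); first exact: chart_exp_nbhs.
apply: jordan_constant_le => H Hg Hf HS; apply: epsP => //.
  by move=> h /HS[_ /SC]; apply: Ad_le_mono; rewrite le_max lexx orbT.
by move=> h /HS[[g Gg [_ [w we <-] <-]] _]; exists g, w.
Qed.

(** Writing a nearby element as [x * (x^-1 * x')] with the second factor in [W] bounds Ad locally by
    5 times its bound at [x]; compactness makes this uniform on [G], and multiplying by [W] costs 5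
    once more. *)
Lemma compact_Ad_le (R : realType) (U : banachLieGroup R) (G : set U)
    (c : chart U (lie_model U)) mu nu q r K :
  chart_dom c 1%g -> local_group_chart G (chart_exp c) mu nu q r K ->
  (forall g, exists C, Ad_le (chart_exp c) C g) -> compact G ->
  exists (W : set U) (C : R), nbhs (1%g : U) W /\
    forall g, set_mulg G W g -> Ad_le (chart_exp c) C g.
Proof.
move=> c1 lc Ad_all /compact_near_coveringP cG.
have r0 : 0 < r := lgc_r_gt0 lc.
pose W : set U := chart_exp c @` [set v | `|v| <= r / 20].
have W1 : nbhs (1%g : U) W by apply: chart_exp_nbhs => //; rewrite divr_gt0.
have WAd w : W w -> Ad_le (chart_exp c) 5 w.
  by move=> [v vr <-]; apply: (Ad_le_ball lc Ad_all); move: vr => /=; lra.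
have [C [C0 CG]] : exists C : R, 0 <= C /\ forall g, G g -> Ad_le (chart_exp c) C g.
  (* Letting the bound run along the filter at [+oo] turns the near-covering form of compactness
     into one bound for all of [G]. *)
  have near_Ad x : G x -> \forall x' \near x & C \near +oo, Ad_le (chart_exp c) C x'.
    move=> Gx; have [C xC] := Ad_all x.
    have H : (x^-1 * x')%g @[x' --> x] --> (1%g : U).
      have H1 : ((x^-1%g, x') : U * U) @[x' --> x] --> ((x^-1%g, x) : U * U).
        by apply: cvg_pair => /=; [exact: cvg_cst|exact: cvg_id].
      by have /= := cvg_comp _ _ H1 (@mulg_continuous U (x^-1%g, x)); rewrite mulVg.
    exists ([set x' | W (x^-1 * x')%g], [set C' | `|C| * 5 < C']).
      split; first exact: (H _ W1).
      by exists (`|C| * 5); split; first exact: num_real.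
    move=> [x' C'] /= [x'W CC']; rewrite -(mulVKg x x').
    apply: (Ad_le_mono (ltW CC')); apply: Ad_le_mul => //; last exact: WAd.
    by apply: Ad_le_mono xC; exact: ler_norm.
  have := cG R +oo (fun C x => Ad_le (chart_exp c) C x) _ near_Ad.
  move=> [M [_ HM]]; exists (Num.max 0 M + 1); split.
    by rewrite addr_ge0 // le_max lexx.
  by apply: HM; rewrite (@le_lt_trans _ _ (Num.max 0 M)) ?ltrDl // le_max lexx orbT.
exists W, (C * 5); split => // _ [g Gg [w Ww <-]].
by apply: Ad_le_mul => //; [exact: CG|exact: WAd].
Qed.

Local Open Scope ereal_scope.

Theorem theoremB (R : realType) (U : banachLieGroup R) (G : set U)
    (hG : lie_subgroup G) :
  (forall S : set U, ad_bounded S ->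
     exists2 V : set U, nbhs (1%g : U) V
       & jordan_constant R (set_mulg G V `&` S) <= jordan_constant R G)
  /\
  (compact G ->
     ereal_inf [set jordan_constant R (set_mulg G V) | V in nbhs (1%g : U)]
       <= jordan_constant R G).
Proof.
have [Ggrp Gsub] := hG.
have [c [F [c1 cA FF' cG]]] := Gsub 1%g ltac:(by case: Ggrp).
have [c0 c0A c01] := atlas_cover (lie_atlas U) 1%g.
have [q [r [K lc]]] := adapted_local_group_chart c1 c01 c0A cA Ggrp FF' cG.
have Ad_all := Ad_le_exists c1 cA c0A c01.
split=> [S [d [dA d1 [C SC]]]|Gcpt].
  (* Ad is bounded in the chart [d] that comes with [ad_bounded], so [d] rather than [c0] is
     compared with the adapted chart [c]. *)
  have [B B0 HB] := Ad_le_chart_exp c1 cA dA d1.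
  apply: (Ad_le_jordan c1 lc Ad_all (C := (B * `|C|)%R)) => g Sg.
  apply: HB => // v; apply: le_trans (SC g Sg v) _.
  by apply: ler_wpM2r => //; exact: ler_norm.
have [W [C [W1 WC]]] := compact_Ad_le c1 lc Ad_all Gcpt.
(* The estimate for bounded Ad is applied with [G * W] as the set [S]; shrinking [V] to [V] meet [W]
   puts [G * V] inside that set. *)
have [V V1 VJ] := Ad_le_jordan c1 lc Ad_all WC.
apply: le_trans VJ; apply: (@le_trans _ _ (jordan_constant R (set_mulg G (V `&` W)))).
  by apply: ereal_inf_lbound; exists (V `&` W) => //; exact: filterI.
apply: jordan_constant_mono => _ [g Gg [v [Vv Wv] <-]].
by split; [exists g => //; exists v|exists g => //; exists v].
Qed.
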